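(* Let $\Omega=\{\omega_1,\dots,\omega_K\}$ be a finite set of scenarios with probabilities $p^{\omega_k}>0$, $\sum_k p^{\omega_k}=1$, and base arrival rates $0<\Lambda_0^{\omega_1}<\Lambda_0^{\omega_2}<\dots<\Lambda_0^{\omega_K}$; for $m\in\mathbb{N}$ set $\Lambda_m^{\omega}=m\Lambda_0^\omega$. Let $\bar c:[0,\infty)\to\mathbb{R}$ be continuous and strictly increasing and, for $m\in\mathbb{N}$, $\beta\ge0$, $\omega\in\Omega$, let $c_m(\beta,\omega)=\bar c\big(\Lambda_m^\omega+\beta\sqrt{\Lambda_m^\omega}\big)$. Let $\epsilon\in(0,1)$ and suppose there is an index $i$ with $\sum_{k=i}^K p^{\omega_k}>\epsilon$ and $\sum_{k=i+1}^K p^{\omega_k}<\epsilon$. Problem $F_m$: minimize $c_m(\beta,\omega^{key})$ over $\beta\ge0$, $\omega^{key}\in\Omega$, subject to $$\sum_{\omega\in\Omega}p^\omega\,\bar\alpha\Big(\Lambda_m^{\omega^{key}}+\beta\sqrt{\Lambda_m^{\omega^{key}}},\ \Lambda_m^\omega\Big)\le\epsilon .$$ Let $\mathbf{W}_m$ be the set of $\omega^{key}$ appearing in some optimal solution $(\beta,\omega^{key})$ of $F_m$. Problem $G_m$: minimize $c_m(\beta,\omega_i)$ over $\beta\ge0$ subject to $p^{\omega_i}\,UB(\beta,\Lambda_m^{\omega_i})\le \epsilon-\sum_{k=i+1}^K p^{\omega_k}$, with optimal solution $\beta^G_m$. Then there exists $\bar m$ such that $\omega_i\in\mathbf{W}_m$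 for all $m\ge\bar m$; and, letting $\beta^F_m$ (for $m\ge\bar m$) denote the optimal $\beta$ of $F_m$ when $\omega^{key}=\omega_i$, there is $\beta^*>0$ with $$\lim_{m\to\infty}\beta^G_m=\lim_{m\to\infty}\beta^F_m=\beta^*.$$
   Context: $\phi,\Phi$ are the standard normal density and distribution function. For $\lambda>0$ and real $n\ge 0$, $\bar\alpha(n,\lambda)=\min\Big\{1,\big[\lambda\int_0^\infty t e^{-\lambda t}(1+t)^{n-1}\,dt\big]^{-1}\Big\}$ is the continuous Erlang-C function (the stationary probability that a customer waits in an $M/M/n$ queue with arrival rate $\lambda$ and service rate 1, extended to real $n$; it equals 1 for $n\le\lambda$). For $\lambda>0,\beta\ge 0$ set $n=\lambda+\beta\sqrt{\lambda}$, $\rho=\lambda/n$, $a=\sqrt{-2n(1-\rho+\ln\rho)}$, $\gamma=(n-\lambda)/\sqrt{n}$, and $UB(\beta,\lambda)=\left[\rho+\gamma\left(\frac{\Phi(a)}{\phi(a)}+\frac{2}{3\sqrt{n}}\right)\right]^{-1}$. It is known (Janssen, van Leeuwaarden and Zwart) that $\bar\alpha(\lambda+\beta\sqrt\lambda,\lambda)\le UB(\beta,\lambda)$ for all $\lambda,\beta>0$. The staffing level chosen by a decision $(\beta,\omega^{key})$ is $\Lambda_m^{\omega^{key}}+\beta\sqrt{\Lambda_m^{\omega^{key}}}$, independent of the realized scenario. *)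

(* Defs.v *)
From Stdlib Require Import Reals Lra Lia ClassicalEpsilon.
Open Scope R_scope.

Definition is_int_0_inf (f : R -> R) (l : R) : Prop :=
  (forall b, 0 <= b -> inhabited (Riemann_integrable f 0 b)) /\
  (forall eps, 0 < eps -> exists M, forall b (pr : Riemann_integrable f 0 b),
      M <= b -> Rabs (RiemannInt pr - l) < eps).

Definition is_int_minf_a (f : R -> R) (a l : R) : Prop :=
  (forall L, L <= a -> inhabited (Riemann_integrable f L a)) /\
  (forall eps, 0 < eps -> exists M, forall L (pr : Riemann_integrable f L a),
      L <= M -> Rabs (RiemannInt pr - l) < eps).

Definition Int_0_inf (f : R -> R) : R := epsilon (inhabits 0) (is_int_0_inf f).
Definition Int_minf (f : R -> R) (a : R) : R := epsilon (inhabits 0) (is_int_minf_a f a).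

(** ** Continuous Erlang-C function
    alpha_bar(n, lam) = min{1, [lam * int_0^oo t e^{-lam t} (1+t)^{n-1} dt]^{-1}} *)
Definition alpha_bar (n lam : R) : R :=
  Rmin 1 (/ (lam * Int_0_inf (fun t => t * exp (- lam * t) * Rpower (1 + t) (n - 1)))).

Definition std_phi (x : R) : R := exp (- (x ^ 2) / 2) / sqrt (2 * PI).
Definition std_Phi (x : R) : R := Int_minf std_phi x.

(** ** The upper bound UB(beta, lam) of Janssen, van Leeuwaarden and Zwart *)
Definition UB (beta lam : R) : R :=
  let n := lam + beta * sqrt lam in
  let rho := lam / n in
  let a := sqrt (- 2 * n * (1 - rho + ln rho)) in
  let gamma := (n - lam) / sqrt n in
  / (rho + gamma * (std_Phi a / std_phi a + 2 / (3 * sqrt n))).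

(** ** Finite sums: sum_range f a b = f a + ... + f (b-1)  (0 if b <= a) *)
Fixpoint sum_from (f : nat -> R) (a n : nat) : R :=
  match n with
  | O => 0
  | S n' => f a + sum_from f (S a) n'
  end.
Definition sum_range (f : nat -> R) (a b : nat) : R := sum_from f a (b - a).

(** ** The model.  Scenarios are indexed 0, ..., K-1 (paper: omega_1..omega_K). *)
Definition Lam (Lam0 : nat -> R) (m k : nat) : R := INR m * Lam0 k.

Definition cost (cbar : R -> R) (Lam0 : nat -> R) (m : nat) (beta : R) (k : nat) : R :=
  cbar (Lam Lam0 m k + beta * sqrt (Lam Lam0 m k)).

Definition continuous_nonneg (f : R -> R) : Prop :=
  forall x, 0 <= x -> forall e, 0 < e -> exists d, 0 < d /\
    forall y, 0 <= y -> Rabs (y - x) < d -> Rabs (f y - f x) < e.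

Definition strictly_incr_nonneg (f : R -> R) : Prop :=
  forall x y, 0 <= x -> x < y -> f x < f y.

Definition F_feasible (K : nat) (p Lam0 : nat -> R) (eps : R) (m : nat)
    (beta : R) (key : nat) : Prop :=
  0 <= beta /\ (key < K)%nat /\
  sum_range (fun k => p k * alpha_bar (Lam Lam0 m key + beta * sqrt (Lam Lam0 m key))
                                      (Lam Lam0 m k)) 0 K <= eps.

Definition F_optimal (K : nat) (p Lam0 : nat -> R) (cbar : R -> R) (eps : R) (m : nat)
    (beta : R) (key : nat) : Prop :=
  F_feasible K p Lam0 eps m beta key /\
  forall beta' key', F_feasible K p Lam0 eps m beta' key' ->
    cost cbar Lam0 m beta key <= cost cbar Lam0 m beta' key'.

Definition W (K : nat) (p Lam0 : nat -> R) (cbar : R -> R) (eps : R) (m : nat)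
    (key : nat) : Prop :=
  exists beta, F_optimal K p Lam0 cbar eps m beta key.

Definition G_feasible (K : nat) (p Lam0 : nat -> R) (eps : R) (i m : nat) (beta : R) : Prop :=
  0 <= beta /\ p i * UB beta (Lam Lam0 m i) <= eps - sum_range p (S i) K.

Definition G_optimal (K : nat) (p Lam0 : nat -> R) (cbar : R -> R) (eps : R) (i m : nat)
    (beta : R) : Prop :=
  G_feasible K p Lam0 eps i m beta /\
  forall beta', G_feasible K p Lam0 eps i m beta' ->
    cost cbar Lam0 m beta i <= cost cbar Lam0 m beta' i.

(* Main.v *)
(** In the regime [n = lam + b sqrt lam], both the Erlang-C probability and its upper bound [UB]
    converge, as [lam -> oo], to the Halfin-Whitt probability [1 / D b], where
    [D b = 1 + b Phi(b) / phi(b)].  For Erlang-C, substitute [t = s / sqrt lam]: the integrand tends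
    to [s exp (b s - s^2 / 2)], whose integral over [0, oo) is [D b].  For [UB] one has
    [gamma <= a <= b], which even gives [1 / D b <= UB b lam] for every [lam].

    The total delay probability in [F_m] depends on [(b, key)] only through the staffing level [n] and
    decreases in [n].  For large [m] the scenarios above [i] contribute their whole weight, those
    below [i] nothing, so near [n = Lam_m^i + b sqrt (Lam_m^i)] the constraint of [F_m] becomes
    [p_i / D b <= eps - sum_(k > i) p_k], exactly as for [G_m].  As [D] is strictly increasing, the
    limit [bstar] is the point where [D] crosses [p_i / (eps - sum_(k > i) p_k) > 1]; the argument needs
    only the crossing, not continuity of [D]. *)

Require Import Defs.
From Stdlib Require Import Reals Lra Lia ClassicalEpsilon.
From Coquelicot Require Import Coquelicot.
Open Scope R_scope.

(** * Taylor-type bounds on [ln (1 + u)] for [u >= 0] *)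

Lemma nonneg_of_deriv_nonneg (f df : R -> R) (x : R) :
  f 0 = 0 -> (forall t, 0 <= t -> is_derive f t (df t)) ->
  (forall t, 0 <= t -> 0 <= df t) -> 0 <= x -> 0 <= f x.
Proof.
  intros f0 Hd Hpos Hx.
  destruct (MVT_gen f 0 x df) as [c [Hc Heq]].
  - intros t Ht. apply Hd. rewrite Rmin_left in Ht; lra.
  - intros t Ht. apply derivable_continuous_pt. rewrite Rmin_left in Ht by lra.
    exists (df t). apply is_derive_Reals. apply Hd; lra.
  - rewrite Rmin_left, Rmax_right in Hc by lra.
    rewrite f0 in Heq. assert (0 <= df c) by (apply Hpos; lra). nra.
Qed.

(** The denominator [1 + u] is what [UB_bounds] needs: with [u = b / mu], this bound becomes exactly
    [a <= b]. *)
Lemma ln_1p_le (u : R) : 0 <= u -> ln (1 + u) <= u - u ^ 2 / (2 * (1 + u)).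
Proof.
  intros Hu.
  enough (0 <= (fun t => t - t ^ 2 / (2 * (1 + t)) - ln (1 + t)) u) by lra.
  apply (nonneg_of_deriv_nonneg (fun t => t - t ^ 2 / (2 * (1 + t)) - ln (1 + t))
    (fun t => t ^ 2 / (2 * (1 + t) ^ 2))); auto.
  - cbv beta. rewrite Rplus_0_r, ln_1. field.
  - intros t Ht. auto_derive; [repeat split; lra |]. field; lra.
  - intros t Ht. cbv beta. apply Rle_mult_inv_pos; nra.
Qed.

Lemma ln_1p_ge (u : R) : 0 <= u -> u - u ^ 2 / 2 <= ln (1 + u).
Proof.
  intros Hu.
  enough (0 <= (fun t => ln (1 + t) - (t - t ^ 2 / 2)) u) by lra.
  apply (nonneg_of_deriv_nonneg (fun t => ln (1 + t) - (t - t ^ 2 / 2))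
    (fun t => t ^ 2 / (1 + t))); auto.
  - cbv beta. rewrite Rplus_0_r, ln_1. field.
  - intros t Ht. auto_derive; [repeat split; lra |]. field; lra.
  - intros t Ht. cbv beta. apply Rle_mult_inv_pos; nra.
Qed.

(** Counterpart of [ln_1p_le] for [UB_bounds]: with [u = b / mu] it becomes exactly [gamma <= a]. *)
Lemma ln_1p_ge_rational (u : R) :
  0 <= u -> u / (1 + u) + u ^ 2 / (2 * (1 + u) ^ 2) <= ln (1 + u).
Proof.
  intros Hu.
  enough (0 <= (fun t => ln (1 + t) - (t / (1 + t) + t ^ 2 / (2 * (1 + t) ^ 2))) u) by lra.
  apply (nonneg_of_deriv_nonneg (fun t => ln (1 + t) - (t / (1 + t) + t ^ 2 / (2 * (1 + t) ^ 2)))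
    (fun t => t ^ 2 / (1 + t) ^ 3)); auto.
  - cbv beta. rewrite Rplus_0_r, ln_1. field.
  - intros t Ht. auto_derive; [repeat split; nra |]. field; lra.
  - intros t Ht. cbv beta. apply Rle_mult_inv_pos; [nra | apply pow_lt; lra].
Qed.

(** * Improper integrals of nonnegative functions *)

Lemma lub_approx (E : R -> Prop) (l e : R) :
  is_lub E l -> 0 < e -> exists x, E x /\ l - e < x.
Proof.
  intros [_ Hleast] He. apply NNPP. intros Hn.
  enough (l <= l - e) by lra. apply Hleast. intros x Hx.
  apply Rnot_lt_le. intros Hlt. apply Hn. eauto.
Qed.

(** Both improper integrals are defined by [epsilon] from a limit predicate. For a nondecreasing
    bounded [F] the supremum satisfies that predicate, and limits are unique, so [epsilon] returns
    the supremum. *)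
Lemma epsilon_limit_lub (F : R -> R) (M : R) (P : R -> Prop) :
  (forall b b', 0 <= b <= b' -> F b <= F b') -> (forall b, 0 <= b -> F b <= M) ->
  (forall l, P l <->
    forall e, 0 < e -> exists B, forall b, 0 <= b -> B <= b -> Rabs (F b - l) < e) ->
  is_lub (fun y => exists b, 0 <= b /\ y = F b) (epsilon (inhabits 0) P).
Proof.
  intros Hmono HM HP.
  destruct (completeness (fun y => exists b, 0 <= b /\ y = F b)) as [l Hl].
  { exists M. intros y [b [Hb ->]]. auto. }
  { exists (F 0), 0. split; [lra | reflexivity]. }
  assert (HPl : P l).
  { apply HP. intros e He.
    destruct (lub_approx _ l e Hl He) as [y [[b0 [Hb0 ->]] Hlt]].
    exists b0. intros b Hb Hb0b.
    assert (F b0 <= F b) by (apply Hmono; lra).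
    assert (F b <= l) by (apply Hl; eauto).
    apply Rabs_def1; lra. }
  replace (epsilon (inhabits 0) P) with l; auto.
  assert (HPe := epsilon_spec (inhabits 0) P (ex_intro _ l HPl)).
  set (l' := epsilon (inhabits 0) P) in *.
  apply cond_eq. intros e He.
  destruct (proj1 (HP l) HPl (e / 2)) as [B1 H1]; [lra |].
  destruct (proj1 (HP l') HPe (e / 2)) as [B2 H2]; [lra |].
  set (b := Rmax 0 (Rmax B1 B2)).
  assert (Hb : 0 <= b) by apply Rmax_l.
  specialize (H1 b Hb (Rle_trans _ _ _ (Rmax_l _ _) (Rmax_r _ _))).
  specialize (H2 b Hb (Rle_trans _ _ _ (Rmax_r _ _) (Rmax_r _ _))).
  apply Rabs_def2 in H1. apply Rabs_def2 in H2. apply Rabs_def1; lra.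
Qed.

Lemma Int_0_inf_lub (f : R -> R) (M : R) :
  (forall b, 0 <= b -> ex_RInt f 0 b) -> (forall x, 0 <= x -> 0 <= f x) ->
  (forall b, 0 <= b -> RInt f 0 b <= M) ->
  is_lub (fun y => exists b, 0 <= b /\ y = RInt f 0 b) (Int_0_inf f).
Proof.
  intros Hex Hpos HM. apply (epsilon_limit_lub (RInt f 0) M); auto.
  - intros b b' Hb.
    assert (Hex' : ex_RInt f b b') by (apply (ex_RInt_Chasles_2 f 0); [lra | apply Hex; lra]).
    rewrite <- (RInt_Chasles f 0 b b') by (auto; apply Hex; lra).
    enough (0 <= RInt f b b') by (unfold plus; simpl; lra).
    apply RInt_ge_0; [lra | auto | intros; apply Hpos; lra].
  - intros l. split.
    + intros [_ H] e He. destruct (H e He) as [B HB]. exists B. intros b Hb HBb.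
      rewrite (RInt_Reals _ _ _ (ex_RInt_Reals_0 _ _ _ (Hex b Hb))). apply HB; auto.
    + intros H. split.
      * intros b Hb. constructor. apply ex_RInt_Reals_0. auto.
      (* The predicate ranges over every [b] beyond the threshold, negative ones included, hence the
         maximum with 0. *)
      * intros e He. destruct (H e He) as [B HB]. exists (Rmax 0 B). intros b pr Hb.
        assert (Hb1 := Rmax_l 0 B). assert (Hb2 := Rmax_r 0 B).
        rewrite <- RInt_Reals. apply HB; lra.
Qed.

(** Writing the lower endpoint as [a - b] with [b >= 0] reduces this to the same monotone limit as
    on [[0, oo)]. *)
Lemma Int_minf_lub (f : R -> R) (a M : R) :
  (forall x y, ex_RInt f x y) -> (forall x, 0 <= f x) ->
  (forall b, 0 <= b -> RInt f (a - b) a <= M) ->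
  is_lub (fun y => exists b, 0 <= b /\ y = RInt f (a - b) a) (Int_minf f a).
Proof.
  intros Hex Hpos HM. apply (epsilon_limit_lub (fun b => RInt f (a - b) a) M); auto.
  - intros b b' Hb. rewrite <- (RInt_Chasles f (a - b') (a - b) a) by auto.
    enough (0 <= RInt f (a - b') (a - b)) by (unfold plus; simpl; lra).
    apply RInt_ge_0; [lra | auto | auto].
  - intros l. split.
    + intros [_ H] e He. destruct (H e He) as [B HB]. exists (a - B). intros b Hb HBb.
      rewrite (RInt_Reals _ _ _ (ex_RInt_Reals_0 _ _ _ (Hex (a - b) a))). apply HB; lra.
    + intros H. split.
      * intros L _. constructor. apply ex_RInt_Reals_0. auto.
      * intros e He. destruct (H e He) as [B HB]. exists (a - Rmax 0 B). intros L pr HL.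
        assert (Hb1 := Rmax_l 0 B). assert (Hb2 := Rmax_r 0 B).
        rewrite <- RInt_Reals. replace L with (a - (a - L)) by ring. apply HB; lra.
Qed.

(** * The Gaussian ratio Phi / phi *)

Lemma exp_le (x y : R) : x <= y -> exp x <= exp y.
Proof. intros [H | ->]; [left; apply exp_increasing; auto | right; auto]. Qed.

Ltac solve_ex_RInt :=
  apply (ex_RInt_continuous (V := R_CompleteNormedModule)); intros ? ?;
  apply (ex_derive_continuous (V := R_NormedModule)); auto_derive.

Lemma RInt_exp_neg (c b : R) :
  c <> 0 -> RInt (fun s => exp (- c * s)) 0 b = (1 - exp (- c * b)) / c.
Proof.
  intros Hc. apply is_RInt_unique.
  replace ((1 - exp (- c * b)) / c)
    with (minus (- exp (- c * b) / c) (- exp (- c * 0) / c)).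
  - apply (is_RInt_derive (fun s => - exp (- c * s) / c)).
    + intros s _. auto_derive; auto. field; auto.
    + intros s _. apply (ex_derive_continuous (V := R_NormedModule)). auto_derive; auto.
  - rewrite Rmult_0_r, exp_0. unfold minus, plus, opp; simpl. field; auto.
Qed.

Lemma RInt_exp_neg_le (c b : R) : 0 < c -> RInt (fun s => exp (- c * s)) 0 b <= / c.
Proof.
  intros Hc. rewrite RInt_exp_neg by lra.
  assert (H := exp_pos (- c * b)). assert (0 < / c) by (apply Rinv_0_lt_compat; lra).
  unfold Rdiv. nra.
Qed.

(** This is [std_phi (a - s) / std_phi a], so its integral over [[0, oo)] is [Phi a / phi a]. *)
Definition gauss (a s : R) : R := exp (a * s - s ^ 2 / 2).

Lemma ex_RInt_gauss (a x y : R) : ex_RInt (gauss a) x y.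
Proof. unfold gauss. solve_ex_RInt; auto. Qed.

(** Completing the square around [a + 1] leaves an integrable exponential. *)
Lemma gauss_le (a s : R) : gauss a s <= exp ((a + 1) ^ 2 / 2) * exp (- 1 * s).
Proof.
  unfold gauss. rewrite <- exp_plus.
  apply exp_le.
  assert (0 <= (s - (a + 1)) ^ 2) by apply pow2_ge_0. nra.
Qed.

(** By symmetry of the normal law, this is its Mills ratio at [- a]. *)
Definition mills (a : R) : R := std_Phi a / std_phi a.

Lemma std_phi_pos (x : R) : 0 < std_phi x.
Proof.
  unfold std_phi. apply Rdiv_lt_0_compat; [apply exp_pos |].
  apply sqrt_lt_R0. assert (H := PI_RGT_0). lra.
Qed.

Lemma ex_RInt_std_phi (x y : R) : ex_RInt std_phi x y.
Proof.
  unfold std_phi. unfold Rdiv.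
  solve_ex_RInt; auto.
Qed.

Lemma RInt_std_phi (a b : R) :
  RInt std_phi (a - b) a = std_phi a * RInt (gauss a) 0 b.
Proof.
  rewrite <- (opp_RInt_swap std_phi) by apply ex_RInt_std_phi.
  assert (H := RInt_comp_lin std_phi (-1) a 0 b).
  replace (-1 * 0 + a) with a in H by ring. replace (-1 * b + a) with (a - b) in H by ring.
  rewrite <- H by apply ex_RInt_std_phi.
  rewrite <- (RInt_opp (V := R_CompleteNormedModule)).
  2:{ unfold std_phi, Rdiv. apply (ex_RInt_continuous (V := R_CompleteNormedModule)).
      intros; apply (ex_derive_continuous (V := R_NormedModule)); unfold scal; simpl; unfold mult; simpl.
      auto_derive; auto. }
  rewrite <- (RInt_scal (V := R_CompleteNormedModule)) by apply ex_RInt_gauss.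
  apply RInt_ext. intros s _. unfold opp, scal; simpl. unfold mult; simpl.
  unfold std_phi, gauss, Rdiv.
  replace (- (-1 * s + a) ^ 2 * / 2) with (- a ^ 2 * / 2 + (a * s - s ^ 2 * / 2)) by field.
  rewrite exp_plus. ring.
Qed.

Lemma RInt_gauss_le (a b : R) : 0 <= b -> RInt (gauss a) 0 b <= exp ((a + 1) ^ 2 / 2).
Proof.
  intros Hb.
  apply Rle_trans with (RInt (fun s => scal (exp ((a + 1) ^ 2 / 2)) (exp (- 1 * s))) 0 b).
  - apply RInt_le; auto; [apply ex_RInt_gauss | | intros; apply gauss_le].
    apply (ex_RInt_scal (V := R_NormedModule)). solve_ex_RInt; auto.
  - rewrite (RInt_scal (V := R_CompleteNormedModule)) by (solve_ex_RInt; auto).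
    unfold scal; simpl; unfold mult; simpl.
    assert (H := RInt_exp_neg_le 1 b Rlt_0_1).
    rewrite Rinv_1 in H. rewrite <- (Rmult_1_r (exp ((a + 1) ^ 2 / 2))) at 2.
    apply Rmult_le_compat_l; [left; apply exp_pos | exact H].
Qed.

(** The normalising constant cancels in the quotient, so the value of the full Gaussian integral
    never enters. Monotonicity and positivity of [mills] are read off from [gauss] through this
    supremum. *)
Lemma mills_lub (a : R) :
  is_lub (fun y => exists b, 0 <= b /\ y = RInt (gauss a) 0 b) (mills a).
Proof.
  assert (Hphi := std_phi_pos a).
  destruct (Int_minf_lub std_phi a (std_phi a * exp ((a + 1) ^ 2 / 2))) as [Hub Hleast].
  - apply ex_RInt_std_phi.
  - intros x. left. apply std_phi_pos.
  - intros b Hb. rewrite RInt_std_phi. apply Rmult_le_compat_l; [lra | apply RInt_gauss_le; auto].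
  - fold (std_Phi a) in Hub, Hleast. unfold mills. split.
    + intros y [b [Hb ->]]. apply Rle_div_r; [lra |].
      apply Hub. exists b. split; [auto |]. rewrite RInt_std_phi. apply Rmult_comm.
    + intros z Hz. apply Rle_div_l; [lra |]. apply Hleast.
      intros y [b [Hb ->]]. rewrite RInt_std_phi, Rmult_comm. apply Rmult_le_compat_r; [lra |].
      apply Hz. eauto.
Qed.

Lemma mills_le (a a' : R) : a <= a' -> mills a <= mills a'.
Proof.
  intros Ha. apply (mills_lub a). intros y [b [Hb ->]].
  apply Rle_trans with (RInt (gauss a') 0 b).
  - apply RInt_le; auto using ex_RInt_gauss. intros s Hs. apply exp_le. nra.
  - apply (mills_lub a'). eauto.
Qed.

Lemma mills_pos (a : R) : 0 < mills a.
Proof.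
  apply Rlt_le_trans with (RInt (gauss a) 0 1).
  - apply RInt_gt_0; [lra | intros; apply exp_pos |].
    intros s _. unfold gauss. apply (ex_derive_continuous (V := R_NormedModule)). auto_derive; auto.
  - apply (mills_lub a). exists 1. split; [lra | auto].
Qed.

(** The reciprocal of the Halfin-Whitt delay probability. *)
Definition halfin_whitt (b : R) : R := 1 + b * mills b.

Lemma halfin_whitt_lt (b b' : R) : 0 <= b < b' -> halfin_whitt b < halfin_whitt b'.
Proof.
  intros Hb. unfold halfin_whitt.
  assert (H1 := mills_le b b'). assert (H2 := mills_pos b). assert (H3 := mills_pos b'). nra.
Qed.

(** Split [s = (s - b) + b]: the first part has primitive [- gauss b]. As [B] grows the right side
    tends to [halfin_whitt b]. *)
Lemma RInt_id_gauss (b B : R) :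
  RInt (fun s => s * gauss b s) 0 B = 1 - gauss b B + b * RInt (gauss b) 0 B.
Proof.
  assert (Hd : is_RInt (fun s => (s - b) * gauss b s) 0 B (minus (- gauss b B) (- gauss b 0))).
  { apply (is_RInt_derive (fun s => - gauss b s)); unfold gauss; intros s _.
    - auto_derive; auto.
      replace (b * s + - (s * (s * 1) * / 2)) with (b * s - s ^ 2 / 2) by field. field.
    - apply (ex_derive_continuous (V := R_NormedModule)). auto_derive; auto. }
  assert (Hg : is_RInt (fun s => scal b (gauss b s)) 0 B (scal b (RInt (gauss b) 0 B))).
  { apply (is_RInt_scal (V := R_NormedModule)). apply (RInt_correct (V := R_CompleteNormedModule)).
    apply ex_RInt_gauss. }
  assert (H := is_RInt_plus _ _ _ _ _ _ Hd Hg).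
  transitivity (plus (minus (- gauss b B) (- gauss b 0)) (scal b (RInt (gauss b) 0 B))).
  - apply is_RInt_unique. eapply is_RInt_ext; [| exact H].
    intros s _. unfold plus, scal; simpl. unfold mult; simpl. ring.
  - unfold plus, minus, scal, opp; simpl. unfold mult, plus; simpl.
    replace (gauss b 0) with 1; [ring |].
    unfold gauss. rewrite <- exp_0. f_equal. field.
Qed.

Lemma RInt_id_gauss_le (b B : R) :
  0 <= b -> 0 <= B -> RInt (fun s => s * gauss b s) 0 B <= halfin_whitt b.
Proof.
  intros Hb HB. rewrite RInt_id_gauss. unfold halfin_whitt.
  assert (0 < gauss b B) by apply exp_pos.
  assert (RInt (gauss b) 0 B <= mills b) by (apply mills_lub; eauto).
  nra.
Qed.

Lemma RInt_id_gauss_approx (b M : R) :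
  0 <= b -> M < halfin_whitt b ->
  exists B, 0 <= B /\ M < RInt (fun s => s * gauss b s) 0 B.
Proof.
  (* Truncating [mills b] costs at most [b * e] and the boundary term [gauss b B] less than [e],
     together below [(2 + b) * e]. *)
  intros Hb HM. set (e := (halfin_whitt b - M) / (2 + b)).
  assert (He : 0 < e) by (apply Rdiv_lt_0_compat; lra).
  assert (Hee : halfin_whitt b - M = e * (2 + b)) by (unfold e; field; lra).
  destruct (lub_approx _ _ e (mills_lub b) He) as [y [[B0 [HB0 ->]] HB1]].
  set (C := exp ((b + 1) ^ 2 / 2)). assert (HC : 0 < C) by apply exp_pos.
  set (B := Rmax B0 (C / e)). exists B.
  assert (HB : B0 <= B) by apply Rmax_l. assert (HB' : C / e <= B) by apply Rmax_r.
  split; [lra |]. rewrite RInt_id_gauss.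
  assert (Hmono : RInt (gauss b) 0 B0 <= RInt (gauss b) 0 B).
  { rewrite <- (RInt_Chasles (gauss b) 0 B0 B) by apply ex_RInt_gauss.
    enough (0 <= RInt (gauss b) B0 B) by (unfold plus; simpl; lra).
    apply RInt_ge_0; [lra | apply ex_RInt_gauss | intros; left; apply exp_pos]. }
  assert (Hg : gauss b B < e).
  { apply Rle_lt_trans with (C * exp (- 1 * B)); [apply gauss_le |].
    replace (-1 * B) with (- B) by ring. rewrite exp_Ropp.
    apply (Rmult_lt_reg_r (exp B)); [apply exp_pos |].
    rewrite Rmult_assoc, Rinv_l by (apply Rgt_not_eq, exp_pos).
    apply Rle_div_l in HB'; [| lra].
    assert (1 + B <= exp B) by (apply exp_ineq1_le). nra. }
  unfold halfin_whitt in Hee. nra.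
Qed.
(** * The continuous Erlang-C function *)

Definition erlang_fun (n lam t : R) : R := t * exp (- lam * t) * Rpower (1 + t) (n - 1).

(** The reciprocal of the Erlang-C probability (for [lam <= n]). *)
Definition erlang_inv (n lam : R) : R := lam * Int_0_inf (erlang_fun n lam).

Lemma alpha_bar_erlang_inv (n lam : R) : alpha_bar n lam = Rmin 1 (/ erlang_inv n lam).
Proof. reflexivity. Qed.

Lemma ex_RInt_erlang_fun (n lam b : R) : 0 <= b -> ex_RInt (erlang_fun n lam) 0 b.
Proof.
  intros Hb. unfold erlang_fun, Rpower. solve_ex_RInt.
  rewrite Rmin_left, Rmax_right in H by lra. lra.
Qed.

Lemma erlang_fun_nonneg (n lam t : R) : 0 <= t -> 0 <= erlang_fun n lam t.
Proof.
  intros Ht. unfold erlang_fun, Rpower.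
  apply Rmult_le_pos; [| left; apply exp_pos].
  apply Rmult_le_pos; [auto | left; apply exp_pos].
Qed.

(** The factor [t] is absorbed by raising the power of [1 + t] from [n - 1] to [n]; that power then
    costs at most half of the exponential decay rate [lam]. *)
Lemma RInt_erlang_fun_bounded (n lam : R) :
  0 < n -> 0 < lam -> exists M, forall b, 0 <= b -> RInt (erlang_fun n lam) 0 b <= M.
Proof.
  (* [d] is the slope of the tangent line bounding [ln (1 + t)] from above; it makes
     [n * d = lam / 2]. *)
  intros Hn Hlam. set (d := lam / (2 * n)).
  assert (Hd : 0 < d) by (apply Rdiv_lt_0_compat; lra).
  set (C := exp (lam / 2 - n - n * ln d)).
  exists (C * / (lam / 2)). intros b Hb.
  apply Rle_trans with (RInt (fun t => scal C (exp (- (lam / 2) * t))) 0 b).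
  - apply RInt_le; auto using ex_RInt_erlang_fun.
    + apply (ex_RInt_scal (V := R_NormedModule)). solve_ex_RInt; auto.
    + intros t Ht. unfold scal; simpl; unfold mult; simpl.
      unfold C. rewrite <- exp_plus.
      apply Rle_trans with (exp (- lam * t) * Rpower (1 + t) n).
      * unfold erlang_fun. replace n with (1 + (n - 1)) at 2 by ring.
        rewrite Rpower_plus, Rpower_1 by lra.
        assert (0 < exp (- lam * t)) by apply exp_pos.
        assert (0 < Rpower (1 + t) (n - 1)) by apply exp_pos.
        assert (0 < exp (- lam * t) * Rpower (1 + t) (n - 1)) by (apply Rmult_lt_0_compat; auto).
        nra.
      * unfold Rpower. rewrite <- exp_plus. apply exp_le.
        assert (Hln : ln (1 + t) <= d * (1 + t) - 1 - ln d).
        { assert (0 < d * (1 + t)) by (apply Rmult_lt_0_compat; lra).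
          assert (E := exp_ineq1_le (ln (d * (1 + t)))).
          rewrite exp_ln in E by auto. rewrite ln_mult in E by lra. lra. }
        assert (H : n * ln (1 + t) <= n * (d * (1 + t) - 1 - ln d))
          by (apply Rmult_le_compat_l; lra).
        replace (n * (d * (1 + t) - 1 - ln d)) with (lam / 2 * (1 + t) - n - n * ln d) in H
          by (unfold d; field; lra).
        lra.
  - rewrite (RInt_scal (V := R_CompleteNormedModule)) by (solve_ex_RInt; auto).
    unfold scal; simpl; unfold mult; simpl.
    apply Rmult_le_compat_l; [left; apply exp_pos |]. apply RInt_exp_neg_le. lra.
Qed.

Lemma erlang_lub (n lam : R) :
  0 < n -> 0 < lam ->
  is_lub (fun y => exists b, 0 <= b /\ y = RInt (erlang_fun n lam) 0 b)
    (Int_0_inf (erlang_fun n lam)).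
Proof.
  intros Hn Hlam. destruct (RInt_erlang_fun_bounded n lam Hn Hlam) as [M HM].
  apply (Int_0_inf_lub _ M); auto using ex_RInt_erlang_fun, erlang_fun_nonneg.
Qed.

(** Together with [erlang_inv_ge], this reduces every estimate of [erlang_inv] to integrals over
    bounded intervals. *)
Lemma erlang_inv_le (n lam M : R) :
  0 < n -> 0 < lam ->
  (forall b, 0 <= b -> lam * RInt (erlang_fun n lam) 0 b <= M) -> erlang_inv n lam <= M.
Proof.
  intros Hn Hlam HM. unfold erlang_inv. rewrite Rmult_comm. apply Rle_div_r; [lra |].
  apply (erlang_lub n lam Hn Hlam). intros y [b [Hb ->]].
  apply Rle_div_r; [lra |]. rewrite Rmult_comm. auto.
Qed.

Lemma erlang_inv_ge (n lam b : R) :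
  0 < n -> 0 < lam -> 0 <= b -> lam * RInt (erlang_fun n lam) 0 b <= erlang_inv n lam.
Proof.
  intros Hn Hlam Hb. apply Rmult_le_compat_l; [lra |].
  apply (erlang_lub n lam Hn Hlam). eauto.
Qed.

Lemma erlang_inv_incr (n n' lam : R) :
  0 < n <= n' -> 0 < lam -> erlang_inv n lam <= erlang_inv n' lam.
Proof.
  intros Hn Hlam. apply erlang_inv_le; [lra | auto |]. intros b Hb.
  apply Rle_trans with (2 := erlang_inv_ge n' lam b ltac:(lra) Hlam Hb).
  apply Rmult_le_compat_l; [lra |].
  apply RInt_le; auto using ex_RInt_erlang_fun. intros t Ht.
  apply Rmult_le_compat_l.
  - apply Rmult_le_pos; [lra | left; apply exp_pos].
  - apply Rle_Rpower; lra.
Qed.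

Lemma erlang_inv_pos (n lam : R) : 0 < n -> 0 < lam -> 0 < erlang_inv n lam.
Proof.
  intros Hn Hlam.
  apply Rlt_le_trans with (2 := erlang_inv_ge n lam 1 Hn Hlam Rle_0_1).
  apply Rmult_lt_0_compat; [auto |].
  apply RInt_gt_0; [lra | |].
  - intros t Ht. apply Rmult_lt_0_compat; [| apply exp_pos].
    apply Rmult_lt_0_compat; [lra | apply exp_pos].
  - intros t Ht. unfold erlang_fun, Rpower.
    apply (ex_derive_continuous (V := R_NormedModule)). auto_derive. lra.
Qed.

(* [- exp (- lam t) (1 + t)^lam] is a primitive of [lam] times the integrand when [n = lam]. *)
Lemma erlang_inv_diag_le (lam : R) : 0 < lam -> erlang_inv lam lam <= 1.
Proof.
  intros Hlam. apply erlang_inv_le; auto. intros b Hb.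
  set (F := fun t => - (exp (- lam * t) * Rpower (1 + t) lam)).
  assert (H : is_RInt (fun t => scal lam (erlang_fun lam lam t)) 0 b (minus (F b) (F 0))).
  { apply (is_RInt_derive F); intros t Ht; rewrite Rmin_left, Rmax_right in Ht by lra;
      unfold F, erlang_fun, Rpower.
    - auto_derive; [lra |]. unfold scal; simpl; unfold mult; simpl.
      replace (lam * ln (1 + t)) with (ln (1 + t) + (lam - 1) * ln (1 + t)) by ring.
      rewrite exp_plus, exp_ln by lra. field. lra.
    - apply (ex_derive_continuous (V := R_NormedModule)).
      unfold scal; simpl; unfold mult; simpl. auto_derive. lra. }
  apply (is_RInt_unique (V := R_CompleteNormedModule)) in H.
  rewrite (RInt_scal (V := R_CompleteNormedModule)) in H by (apply ex_RInt_erlang_fun; auto).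
  change (lam * RInt (erlang_fun lam lam) 0 b = minus (F b) (F 0)) in H. rewrite H.
  unfold minus, plus, opp; simpl. unfold F.
  rewrite Rmult_0_r, exp_0, Rplus_0_r. unfold Rpower at 2. rewrite ln_1, Rmult_0_r, exp_0.
  assert (0 < exp (- lam * b) * Rpower (1 + b) lam) by (apply Rmult_lt_0_compat; apply exp_pos).
  lra.
Qed.

Lemma alpha_bar_eq_1 (n lam : R) : 0 < n <= lam -> alpha_bar n lam = 1.
Proof.
  intros Hn. rewrite alpha_bar_erlang_inv. apply Rmin_left.
  rewrite <- Rinv_1. apply Rinv_le_contravar; [apply erlang_inv_pos; lra |].
  apply Rle_trans with (erlang_inv lam lam);
    [apply erlang_inv_incr | apply erlang_inv_diag_le]; lra.
Qed.

Lemma alpha_bar_le_1 (n lam : R) : alpha_bar n lam <= 1.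
Proof. apply Rmin_l. Qed.

Lemma alpha_bar_pos (n lam : R) : 0 < n -> 0 < lam -> 0 < alpha_bar n lam.
Proof.
  intros. rewrite alpha_bar_erlang_inv. apply Rmin_glb_lt; [lra |].
  apply Rinv_0_lt_compat. apply erlang_inv_pos; auto.
Qed.

Lemma alpha_bar_decr (n n' lam : R) :
  0 < n <= n' -> 0 < lam -> alpha_bar n' lam <= alpha_bar n lam.
Proof.
  intros Hn Hlam. rewrite !alpha_bar_erlang_inv. apply Rle_min_compat_l.
  apply Rinv_le_contravar; [apply erlang_inv_pos | apply erlang_inv_incr]; lra.
Qed.

(* Convexity of [exp], applied to [(1 + t)^th]. *)
Lemma Rpower_chord (x th : R) : 0 < x -> 0 <= th <= 1 -> Rpower x th <= 1 + th * (x - 1).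
Proof.
  intros Hx Hth.
  destruct (Req_dec th 0) as [-> | Hth0]; [rewrite Rpower_O by auto; lra |].
  set (y := 1 + th * (x - 1)).
  assert (Hy : 0 < y) by (unfold y; nra).
  rewrite <- (exp_ln y) by auto. apply exp_le.
  assert (E1 := exp_ineq1_le (ln (x / y))). rewrite exp_ln in E1 by (apply Rdiv_lt_0_compat; auto).
  assert (E2 := exp_ineq1_le (ln (1 / y))). rewrite exp_ln in E2 by (apply Rdiv_lt_0_compat; lra).
  rewrite ln_div in E1, E2 by lra. rewrite ln_1 in E2.
  assert (E : th * (x / y) + (1 - th) * (1 / y) = 1) by (unfold y; field; unfold y in Hy; lra).
  nra.
Qed.

(** Holds under the integral sign by [Rpower_chord]. It gives an explicit modulus of right
    continuity in [n] without exchanging a limit and an integral. *)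
Lemma erlang_inv_chord (n lam th : R) :
  0 < n -> 0 < lam -> 0 <= th <= 1 ->
  erlang_inv (n + th) lam <= erlang_inv n lam + th * (erlang_inv (n + 1) lam - erlang_inv n lam).
Proof.
  intros Hn Hlam Hth. apply erlang_inv_le; [lra | auto |]. intros b Hb.
  set (I0 := RInt (erlang_fun n lam) 0 b). set (I1 := RInt (erlang_fun (n + 1) lam) 0 b).
  assert (H0 : lam * I0 <= erlang_inv n lam) by (apply erlang_inv_ge; auto).
  assert (H1 : lam * I1 <= erlang_inv (n + 1) lam) by (apply erlang_inv_ge; lra).
  assert (Hex0 := ex_RInt_erlang_fun n lam b Hb).
  assert (Hex1 := ex_RInt_erlang_fun (n + 1) lam b Hb).
  assert (Hcomb : is_RInt (fun t => plus (scal (1 - th) (erlang_fun n lam t))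
      (scal th (erlang_fun (n + 1) lam t))) 0 b (plus (scal (1 - th) I0) (scal th I1))).
  { apply (is_RInt_plus (V := R_NormedModule));
      apply (is_RInt_scal (V := R_NormedModule));
      apply (RInt_correct (V := R_CompleteNormedModule)); auto. }
  assert (H : RInt (erlang_fun (n + th) lam) 0 b <= (1 - th) * I0 + th * I1).
  { change ((1 - th) * I0 + th * I1) with (plus (scal (1 - th) I0) (scal th I1)).
    rewrite <- (is_RInt_unique (V := R_CompleteNormedModule) _ _ _ _ Hcomb).
    apply RInt_le; auto using ex_RInt_erlang_fun; [eexists; apply Hcomb |].
    intros t Ht. unfold plus, scal; simpl; unfold mult; simpl. unfold erlang_fun.
    replace (n + th - 1) with ((n - 1) + th) by ring.
    replace (n + 1 - 1) with ((n - 1) + 1) by ring.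
    rewrite !Rpower_plus, Rpower_1 by lra.
    assert (Hc := Rpower_chord (1 + t) th ltac:(lra) Hth).
    assert (0 < exp (- lam * t)) by apply exp_pos.
    assert (0 < Rpower (1 + t) (n - 1)) by apply exp_pos.
    assert (0 <= t * exp (- lam * t) * Rpower (1 + t) (n - 1))
      by (apply Rmult_le_pos; [apply Rmult_le_pos |]; lra).
    nra. }
  apply (Rmult_le_compat_l lam) in H; [| lra]. nra.
Qed.

Lemma alpha_bar_right_lipschitz (n lam : R) :
  0 < n -> 0 < lam -> exists C, 0 <= C /\
    forall th, 0 <= th <= 1 -> alpha_bar n lam <= alpha_bar (n + th) lam + th * C.
Proof.
  intros Hn Hlam.
  set (I0 := erlang_inv n lam). set (I1 := erlang_inv (n + 1) lam).
  assert (H0 : 0 < I0) by (apply erlang_inv_pos; auto).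
  assert (H1 : I0 <= I1) by (apply erlang_inv_incr; lra).
  (* The slope of the chord, times the bound [/ I0 ^ 2] on the slope of the inverse over
     [[I0, oo)]. *)
  exists ((I1 - I0) / I0 ^ 2). split.
  { apply Rle_mult_inv_pos; [lra | apply pow_lt; auto]. }
  intros th Hth. rewrite !alpha_bar_erlang_inv. fold I0.
  assert (Hc := erlang_inv_chord n lam th Hn Hlam Hth). fold I0 I1 in Hc.
  assert (Hm := erlang_inv_incr n (n + th) lam ltac:(lra) Hlam). fold I0 in Hm.
  set (J := erlang_inv (n + th) lam) in *.
  assert (HJ : / I0 <= / J + th * ((I1 - I0) / I0 ^ 2)).
  { assert (E : / I0 - / J <= (J - I0) / I0 ^ 2).
    { replace (/ I0 - / J) with ((J - I0) / I0 * / J) by (field; lra).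
      replace ((J - I0) / I0 ^ 2) with ((J - I0) / I0 * / I0) by (field; lra).
      apply Rmult_le_compat_l; [apply Rle_mult_inv_pos; lra | apply Rinv_le_contravar; lra]. }
    assert ((J - I0) / I0 ^ 2 <= th * ((I1 - I0) / I0 ^ 2)).
    { replace (th * ((I1 - I0) / I0 ^ 2)) with (th * (I1 - I0) / I0 ^ 2) by (field; lra).
      apply Rmult_le_compat_r; [left; apply Rinv_0_lt_compat, pow_lt; auto | lra]. }
    lra. }
  assert (0 <= th * ((I1 - I0) / I0 ^ 2)).
  { apply Rmult_le_pos; [lra |]. apply Rle_mult_inv_pos; [lra | apply pow_lt; auto]. }
  unfold Rmin. destruct (Rle_dec 1 (/ I0)); destruct (Rle_dec 1 (/ J)); lra.
Qed.
(** * The Halfin-Whitt limit *)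

(** The integrand of [erlang_inv (mu ^ 2 + b * mu) (mu ^ 2)] after the substitution [t = s / mu]. *)
Definition qed_fun (b mu s : R) : R :=
  s * exp (- mu * s + (mu ^ 2 + b * mu - 1) * ln (1 + s / mu)).

Lemma ex_RInt_qed_fun (b mu B : R) : 0 < mu -> 0 <= B -> ex_RInt (qed_fun b mu) 0 B.
Proof.
  intros Hmu HB. unfold qed_fun. solve_ex_RInt.
  rewrite Rmin_left, Rmax_right in H by lra.
  assert (0 <= z * / mu) by (apply Rmult_le_pos; [lra | left; apply Rinv_0_lt_compat; auto]).
  lra.
Qed.

Lemma RInt_qed_fun (b mu B : R) :
  0 < mu -> 0 <= B ->
  mu ^ 2 * RInt (erlang_fun (mu ^ 2 + b * mu) (mu ^ 2)) 0 B = RInt (qed_fun b mu) 0 (mu * B).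
Proof.
  intros Hmu HB. set (f := erlang_fun (mu ^ 2 + b * mu) (mu ^ 2)).
  assert (H := RInt_comp_lin f (/ mu) 0 0 (mu * B)).
  replace (/ mu * 0 + 0) with 0 in H by ring.
  replace (/ mu * (mu * B) + 0) with B in H by (field; lra).
  rewrite <- H by (apply ex_RInt_erlang_fun; auto).
  rewrite <- (RInt_scal (V := R_CompleteNormedModule)).
  - apply RInt_ext. intros s _. unfold scal; simpl; unfold mult; simpl.
    unfold f, erlang_fun, qed_fun, Rpower. rewrite exp_plus.
    replace (/ mu * s + 0) with (s / mu) by (field; lra).
    replace (- mu ^ 2 * (s / mu)) with (- mu * s) by (field; lra).
    field. lra.
  - assert (H' := ex_RInt_comp_lin f (/ mu) 0 0 (mu * B)).
    apply H'. replace (/ mu * 0 + 0) with 0 by ring.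
    replace (/ mu * (mu * B) + 0) with B by (field; lra).
    apply ex_RInt_erlang_fun; auto.
Qed.

(** With [u = s / mu], use [ln_1p_le] on the [mu ^ 2] term, [ln (1 + u) <= u] on the [b * mu] term,
    and drop [- ln (1 + u)]; the terms linear in [mu] cancel. *)
Lemma qed_exponent_le (b mu s : R) :
  0 <= b -> 0 < mu -> 0 <= s ->
  - mu * s + (mu ^ 2 + b * mu - 1) * ln (1 + s / mu) <= b * s - s ^ 2 / (2 * (1 + s / mu)).
Proof.
  intros Hb Hmu Hs. set (u := s / mu).
  assert (Hu : 0 <= u) by (apply Rle_mult_inv_pos; auto).
  assert (Es : s = mu * u) by (unfold u; field; lra).
  assert (H1 := ln_1p_le u Hu).
  assert (H0 : 0 <= ln (1 + u)).
  { rewrite <- ln_1. destruct Hu as [Hu | <-]; [left; apply ln_increasing; lra | right; f_equal; ring]. }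
  assert (H2 : ln (1 + u) <= u).
  { assert (0 <= u ^ 2 / (2 * (1 + u))) by (apply Rle_mult_inv_pos; nra). lra. }
  rewrite Es.
  replace ((mu * u) ^ 2 / (2 * (1 + u))) with (mu ^ 2 * (u ^ 2 / (2 * (1 + u)))) by (field; lra).
  assert (0 <= mu ^ 2) by nra.
  assert (mu ^ 2 * ln (1 + u) <= mu ^ 2 * (u - u ^ 2 / (2 * (1 + u))))
    by (apply Rmult_le_compat_l; auto).
  assert (b * mu * ln (1 + u) <= b * mu * u)
    by (apply Rmult_le_compat_l; [apply Rmult_le_pos; lra | auto]).
  nra.
Qed.

(** The error collects [ln (1 + u) <= u <= B / mu] and the quadratic term [b * mu * u ^ 2 / 2 <= b *
    B ^ 2 / (2 * mu)], where [u = s / mu]. *)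
Lemma qed_exponent_ge (b mu s B : R) :
  0 <= b -> 0 < mu -> 0 <= s <= B ->
  b * s - s ^ 2 / 2 - (B + b * B ^ 2 / 2) / mu <=
  - mu * s + (mu ^ 2 + b * mu - 1) * ln (1 + s / mu).
Proof.
  intros Hb Hmu Hs. set (u := s / mu).
  assert (Hu : 0 <= u) by (apply Rle_mult_inv_pos; lra).
  assert (Es : s = mu * u) by (unfold u; field; lra).
  assert (H1 := ln_1p_ge u Hu).
  assert (H2 : ln (1 + u) <= u).
  { assert (H := ln_1p_le u Hu).
    assert (0 <= u ^ 2 / (2 * (1 + u))) by (apply Rle_mult_inv_pos; nra). lra. }
  assert (H3 : (mu ^ 2 + b * mu) * (u - u ^ 2 / 2) <= (mu ^ 2 + b * mu) * ln (1 + u))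
    by (apply Rmult_le_compat_l; [nra | auto]).
  assert (H4 : u + b * mu * u ^ 2 / 2 <= (B + b * B ^ 2 / 2) / mu).
  { apply Rle_div_r; [auto |].
    replace ((u + b * mu * u ^ 2 / 2) * mu) with (s + b * s ^ 2 / 2) by (rewrite Es; field).
    assert (b * s ^ 2 <= b * B ^ 2) by (apply Rmult_le_compat_l; [lra | apply pow_incr; lra]). lra. }
  rewrite Es. nra.
Qed.

(* The first term dominates on [0, B], the second one on [B, +oo). *)
Lemma qed_fun_le (b B mu r s : R) :
  0 <= b -> 4 * (b + 2) <= B -> B <= mu -> 0 <= r -> B ^ 3 / (2 * mu) <= ln (1 + r) -> 0 <= s ->
  qed_fun b mu s <= (1 + r) * (s * gauss b s) + exp (- B / 2) * exp (- (1 / 2) * s).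
Proof.
  intros Hb HB Hmu Hr HBr Hs.
  assert (Hexp := qed_exponent_le b mu s Hb ltac:(lra) Hs).
  assert (Hg : 0 < gauss b s) by apply exp_pos.
  assert (Hu : 0 <= s / mu) by (apply Rle_mult_inv_pos; lra).
  destruct (Rle_lt_dec s B) as [HsB | HsB].
  - apply Rle_trans with ((1 + r) * (s * gauss b s)).
    2:{ assert (0 < exp (- B / 2) * exp (- (1 / 2) * s))
          by (apply Rmult_lt_0_compat; apply exp_pos). lra. }
    rewrite (Rmult_comm (1 + r)), Rmult_assoc. apply Rmult_le_compat_l; [auto |].
    rewrite <- (exp_ln (1 + r)) by lra. unfold gauss. rewrite <- exp_plus. apply exp_le.
    apply Rle_trans with (1 := Hexp).
    enough (s ^ 2 / 2 - s ^ 2 / (2 * (1 + s / mu)) <= B ^ 3 / (2 * mu)) by lra.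
    replace (s ^ 2 / 2 - s ^ 2 / (2 * (1 + s / mu))) with (s ^ 3 / (2 * mu) * / (1 + s / mu))
      by (field; lra).
    apply Rle_trans with (s ^ 3 / (2 * mu)).
    + rewrite <- (Rmult_1_r (s ^ 3 / (2 * mu))) at 2. apply Rmult_le_compat_l.
      * apply Rle_mult_inv_pos; [apply pow_le; auto | lra].
      * rewrite <- Rinv_1. apply Rinv_le_contravar; lra.
    + apply Rmult_le_compat_r; [left; apply Rinv_0_lt_compat; lra |]. apply pow_incr; lra.
  - apply Rle_trans with (exp (- B / 2) * exp (- (1 / 2) * s)).
    2:{ assert (0 <= (1 + r) * (s * gauss b s))
          by (apply Rmult_le_pos; [| apply Rmult_le_pos]; lra). lra. }
    (* For [s > B] and [mu >= B], [1 + s / mu <= 2 * s / B], so the quotient is at least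
       [s * B / 4]. The exponent is then at most [- 2 * s], and bounding the prefactor [s] by
       [exp s] still leaves [exp (- s)]. *)
    assert (Hq : (b + 2) * s <= s ^ 2 / (2 * (1 + s / mu))).
    { apply (Rle_div_r ((b + 2) * s)); [lra |].
      assert (s / mu <= s / B).
      { apply Rmult_le_compat_l; [auto | apply Rinv_le_contravar; lra]. }
      assert (HsB' : (s / B) * B = s) by (field; lra).
      set (v := s / B) in *.
      assert (1 <= v) by nra.
      assert ((b + 2) * s * (2 * (1 + s / mu)) <= (b + 2) * s * (4 * v))
        by (apply Rmult_le_compat_l; [apply Rmult_le_pos |]; lra).
      apply Rle_trans with (1 := H1). replace (s ^ 2) with (s * (B * v)) by (rewrite <- HsB'; ring).
      replace ((b + 2) * s * (4 * v)) with (s * (4 * (b + 2) * v)) by ring.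
      apply Rmult_le_compat_l; [auto |]. apply Rmult_le_compat_r; lra. }
    apply Rle_trans with (exp s * exp (- 2 * s)).
    + unfold qed_fun. apply Rmult_le_compat; [auto | left; apply exp_pos | |].
      * assert (H := exp_ineq1_le s). lra.
      * apply exp_le. lra.
    + rewrite <- !exp_plus. apply exp_le. lra.
Qed.

(** The cut-off [B] is fixed before [mu], and the bound of [qed_fun_le] integrates to at most [M]
    over every [[0, L]]; this takes the place of dominated convergence. *)
Lemma erlang_inv_qed_le (b M : R) :
  0 <= b -> halfin_whitt b < M ->
  exists mu0, 0 < mu0 /\ forall mu, mu0 <= mu -> erlang_inv (mu ^ 2 + b * mu) (mu ^ 2) <= M.
Proof.
  intros Hb HM. set (D := halfin_whitt b) in *.
  assert (HD : 0 < D).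
  { unfold D, halfin_whitt. assert (H := mills_pos b). nra. }
  (* Half of the slack pays for the factor [1 + r], as [(1 + r) * D = D + e]; the other half pays
     for the tail, at most [2 * exp (- B / 2)]. *)
  set (e := (M - D) / 2). assert (He : 0 < e) by (unfold e; lra).
  set (B := Rmax (4 * (b + 2)) (4 / e)).
  assert (HB1 : 4 * (b + 2) <= B) by apply Rmax_l.
  assert (HB2 : 4 / e <= B) by apply Rmax_r.
  set (r := e / D). assert (Hr : 0 < r) by (apply Rdiv_lt_0_compat; auto).
  assert (Hln : 0 < ln (1 + r)) by (rewrite <- ln_1; apply ln_increasing; lra).
  exists (Rmax B (B ^ 3 / (2 * ln (1 + r)))). split.
  { apply Rlt_le_trans with B; [lra | apply Rmax_l]. }
  intros mu Hmu.
  assert (Hmu1 : B <= mu) by (apply Rle_trans with (2 := Hmu); apply Rmax_l).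
  assert (Hmu2 : B ^ 3 / (2 * mu) <= ln (1 + r)).
  { assert (H : B ^ 3 / (2 * ln (1 + r)) <= mu) by (apply Rle_trans with (2 := Hmu); apply Rmax_r).
    apply Rle_div_l in H; [| lra]. apply Rle_div_l; lra. }
  assert (Htail : exp (- B / 2) * 2 <= e).
  { replace (- B / 2) with (- (B / 2)) by field. rewrite exp_Ropp.
    apply (Rmult_le_reg_l (exp (B / 2))); [apply exp_pos |].
    rewrite <- Rmult_assoc, Rinv_r by (apply Rgt_not_eq, exp_pos).
    apply Rle_div_l in HB2; [| auto].
    assert (H := exp_ineq1_le (B / 2)). nra. }
  apply erlang_inv_le; [nra | apply pow_lt; lra |].
  intros b0 Hb0. rewrite RInt_qed_fun by lra.
  set (L := mu * b0). assert (HL : 0 <= L) by (apply Rmult_le_pos; lra).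
  set (J := RInt (fun s => s * gauss b s) 0 L). set (T := RInt (fun s => exp (- (1 / 2) * s)) 0 L).
  assert (Hcomb : is_RInt (fun s => plus (scal (1 + r) (s * gauss b s))
      (scal (exp (- B / 2)) (exp (- (1 / 2) * s)))) 0 L
      (plus (scal (1 + r) J) (scal (exp (- B / 2)) T))).
  { apply (is_RInt_plus (V := R_NormedModule));
      apply (is_RInt_scal (V := R_NormedModule));
      apply (RInt_correct (V := R_CompleteNormedModule)).
    - unfold gauss. solve_ex_RInt; auto.
    - solve_ex_RInt; auto. }
  apply Rle_trans with (plus (scal (1 + r) J) (scal (exp (- B / 2)) T)).
  - rewrite <- (is_RInt_unique (V := R_CompleteNormedModule) _ _ _ _ Hcomb).
    apply RInt_le; [auto | apply ex_RInt_qed_fun; lra | eexists; apply Hcomb |].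
    intros s Hs. apply qed_fun_le; lra.
  - unfold plus, scal; simpl; unfold mult; simpl.
    assert (HJ : J <= D) by (apply RInt_id_gauss_le; auto).
    assert (HT : T <= / (1 / 2)) by (apply RInt_exp_neg_le; lra).
    replace (/ (1 / 2)) with 2 in HT by field.
    assert (E : (1 + r) * D = D + e) by (unfold r; field; lra).
    assert ((1 + r) * J <= (1 + r) * D) by (apply Rmult_le_compat_l; lra).
    assert (exp (- B / 2) * T <= exp (- B / 2) * 2)
      by (apply Rmult_le_compat_l; [left; apply exp_pos | auto]).
    unfold e in *. lra.
Qed.

Lemma erlang_inv_qed_ge (b M : R) :
  0 <= b -> M < halfin_whitt b ->
  exists mu0, 0 < mu0 /\ forall mu, mu0 <= mu -> M <= erlang_inv (mu ^ 2 + b * mu) (mu ^ 2).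
Proof.
  intros Hb HM.
  destruct (RInt_id_gauss_approx b M Hb HM) as [B [HB HMB]].
  set (J := RInt (fun s => s * gauss b s) 0 B) in *.
  assert (Hexg : ex_RInt (fun s => s * gauss b s) 0 B) by (unfold gauss; solve_ex_RInt; auto).
  assert (HJ : 0 <= J).
  { apply RInt_ge_0; auto. intros s Hs. apply Rmult_le_pos; [lra | left; apply exp_pos]. }
  set (C := B + b * B ^ 2 / 2). assert (HC : 0 <= C) by (unfold C; nra).
  (* The integral loses at most the fraction [C / mu] of [J], and beyond this threshold
     [J * C / mu <= J - M]. *)
  exists (1 + J * C / (J - M)).
  assert (HJC : 0 <= J * C / (J - M)) by (apply Rle_mult_inv_pos; nra).
  split; [lra |]. intros mu Hmu.
  apply Rle_trans with (mu ^ 2 * RInt (erlang_fun (mu ^ 2 + b * mu) (mu ^ 2)) 0 (B / mu)).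
  2:{ apply erlang_inv_ge; [nra | apply pow_lt; lra | apply Rle_mult_inv_pos; lra]. }
  rewrite RInt_qed_fun; [| lra | apply Rle_mult_inv_pos; lra].
  replace (mu * (B / mu)) with B by (field; lra).
  apply Rle_trans with (RInt (fun s => scal (1 - C / mu) (s * gauss b s)) 0 B).
  - rewrite (RInt_scal (V := R_CompleteNormedModule)) by auto.
    unfold scal; simpl; unfold mult; simpl. fold J.
    assert (HCmu : J * (C / mu) <= J - M).
    { replace (J * (C / mu)) with ((J * C) / mu) by (field; lra).
      apply Rle_div_l; [lra |].
      assert (H : J * C / (J - M) <= mu) by lra.
      apply Rle_div_l in H; lra. }
    lra.
  - apply RInt_le; auto.
    + apply (ex_RInt_scal (V := R_NormedModule)). auto.
    + apply ex_RInt_qed_fun; lra.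
    + intros s Hs. unfold scal; simpl; unfold mult; simpl. unfold qed_fun.
      rewrite <- Rmult_assoc, (Rmult_comm _ s), Rmult_assoc.
      apply Rmult_le_compat_l; [lra |].
      apply Rle_trans with (exp (- (C / mu)) * gauss b s).
      * apply Rmult_le_compat_r; [left; apply exp_pos |].
        assert (H := exp_ineq1_le (- (C / mu))). lra.
      * unfold gauss. rewrite <- exp_plus. apply exp_le.
        assert (H := qed_exponent_ge b mu s B Hb ltac:(lra) ltac:(lra)). fold C in H. lra.
Qed.
(** * The upper bound UB *)

(* [gamma <= a <= b], where [gamma = b / sqrt (1 + b / mu)]. *)
Lemma UB_bounds (b mu : R) :
  0 <= b -> 0 < mu ->
  let u := b / mu in let g := b / sqrt (1 + u) in
  / halfin_whitt b <= UB b (mu ^ 2) <= / (/ (1 + u) + g * mills g).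
Proof.
  intros Hb Hmu u g.
  assert (Hu : 0 <= u) by (apply Rle_mult_inv_pos; auto).
  assert (Eb : b = mu * u) by (unfold u; field; lra).
  set (n := mu ^ 2 + b * mu).
  assert (En : n = mu ^ 2 * (1 + u)) by (unfold n; rewrite Eb; ring).
  assert (Hmu2 : 0 < mu ^ 2) by (apply pow_lt; auto).
  assert (Hn : 0 < n) by (rewrite En; apply Rmult_lt_0_compat; lra).
  assert (Hs : 0 < sqrt (1 + u)) by (apply sqrt_lt_R0; lra).
  assert (Hss : sqrt (1 + u) * sqrt (1 + u) = 1 + u) by (apply sqrt_sqrt; lra).
  assert (Hg : 0 <= g) by (apply Rle_mult_inv_pos; auto).
  assert (Erho : mu ^ 2 / n = / (1 + u)) by (rewrite En; field; lra).
  assert (Esn : sqrt n = mu * sqrt (1 + u)).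
  { rewrite En, sqrt_mult by lra. rewrite sqrt_pow2 by lra. reflexivity. }
  assert (Egam : (n - mu ^ 2) / sqrt n = g).
  { replace (n - mu ^ 2) with (b * mu) by (unfold n; ring).
    rewrite Esn. unfold g. field. lra. }
  set (a := sqrt (-2 * n * (1 - / (1 + u) + ln (/ (1 + u))))).
  assert (Ea : -2 * n * (1 - / (1 + u) + ln (/ (1 + u))) = 2 * n * (ln (1 + u) - u / (1 + u))).
  { rewrite ln_Rinv by lra. field. lra. }
  assert (Hab : a <= b).
  { unfold a. rewrite Ea. rewrite <- (sqrt_pow2 b) by auto. apply sqrt_le_1_alt.
    replace (b ^ 2) with (2 * n * ((u - u ^ 2 / (2 * (1 + u))) - u / (1 + u)))
      by (rewrite En, Eb; field; lra).
    apply Rmult_le_compat_l; [lra |]. assert (H := ln_1p_le u Hu). lra. }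
  assert (Hga : g <= a).
  { unfold a. rewrite Ea. rewrite <- (sqrt_pow2 g) by auto. apply sqrt_le_1_alt.
    replace (g ^ 2) with (2 * n * (u ^ 2 / (2 * (1 + u) ^ 2))).
    - apply Rmult_le_compat_l; [lra |]. assert (H := ln_1p_ge_rational u Hu). lra.
    - unfold g. replace ((b / sqrt (1 + u)) ^ 2) with (b ^ 2 / (sqrt (1 + u) * sqrt (1 + u)))
        by (field; lra).
      rewrite Hss, En, Eb. field. lra. }
  assert (Hgb : g <= b) by lra.
  (* The correction [2 / (3 * sqrt n)] contributes [2 / 3 * (1 - rho)], so its sum with [rho] stays
     between [rho] and 1; this serves both bounds. *)
  assert (EUB : UB b (mu ^ 2) = / (/ (1 + u) + g * mills a + 2 / 3 * (1 - / (1 + u)))).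
  { unfold UB. rewrite sqrt_pow2 by lra. fold n. rewrite Erho, Egam. fold a. fold (mills a).
    f_equal. rewrite Rmult_plus_distr_l, <- Rplus_assoc. f_equal.
    assert (Hsn : 0 < sqrt n) by (apply sqrt_lt_R0; auto).
    rewrite <- Egam, <- Erho.
    replace ((n - mu ^ 2) / sqrt n * (2 / (3 * sqrt n)))
      with (2 / 3 * ((n - mu ^ 2) / (sqrt n * sqrt n))) by (field; lra).
    rewrite sqrt_sqrt by lra. field. lra. }
  assert (Hrho : 0 < / (1 + u) <= 1).
  { split; [apply Rinv_0_lt_compat; lra |]. rewrite <- Rinv_1. apply Rinv_le_contravar; lra. }
  assert (Hm1 := mills_le a b Hab). assert (Hm2 := mills_le g a Hga).
  assert (Hm3 := mills_pos g).
  assert (0 <= g * mills g <= g * mills a)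
    by (split; [apply Rmult_le_pos | apply Rmult_le_compat_l]; lra).
  assert (g * mills a <= b * mills b) by (apply Rmult_le_compat; lra).
  rewrite EUB. unfold halfin_whitt.
  split; apply Rinv_le_contravar; lra.
Qed.

(** Comparing with a strictly smaller [b'] makes monotonicity of [mills] sufficient, with no appeal
    to its continuity. *)
Lemma UB_le_eventually (b b' : R) :
  0 <= b' < b ->
  exists mu0, 0 < mu0 /\ forall mu, mu0 <= mu -> UB b (mu ^ 2) <= / halfin_whitt b'.
Proof.
  intros Hb. set (c := (b' + b) / 2). assert (Hc : b' < c < b) by (unfold c; lra).
  assert (Hm := mills_pos b').
  (* The first bound on [u = b / mu] gives [c <= g]; the second lets the gain [(c - b') * mills b']
     cover the loss in [1 - u <= rho]. *)
  set (u0 := Rmin ((b - c) / b) ((c - b') * mills b')).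
  assert (Hu0 : 0 < u0).
  { apply Rmin_glb_lt; [apply Rdiv_lt_0_compat | apply Rmult_lt_0_compat]; lra. }
  exists (b / u0). split; [apply Rdiv_lt_0_compat; lra |]. intros mu Hmu.
  assert (Hmu0 : 0 < mu).
  { apply Rlt_le_trans with (2 := Hmu). apply Rdiv_lt_0_compat; lra. }
  destruct (UB_bounds b mu) as [_ H]; [lra | auto |].
  set (u := b / mu) in *. set (g := b / sqrt (1 + u)) in *.
  assert (Hu : 0 < u) by (apply Rdiv_lt_0_compat; lra).
  assert (Huu : u <= u0).
  { apply Rle_div_l in Hmu; [| auto]. apply (Rle_div_l b); [auto | lra]. }
  assert (Hu1 : u * b <= b - c).
  { apply (Rle_div_r u); [lra |]. apply Rle_trans with (1 := Huu). apply Rmin_l. }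
  assert (Hu2 : u <= (c - b') * mills b') by (apply Rle_trans with (1 := Huu); apply Rmin_r).
  assert (Hs : 0 < sqrt (1 + u)) by (apply sqrt_lt_R0; lra).
  assert (Hs' : sqrt (1 + u) <= 1 + u).
  { assert (E : sqrt (1 + u) * sqrt (1 + u) = 1 + u) by (apply sqrt_sqrt; lra). nra. }
  assert (Hgc : c <= g).
  { apply (Rle_div_r c); auto.
    apply Rle_trans with (c * (1 + u)); [apply Rmult_le_compat_l; lra | nra]. }
  assert (Hrho : 1 - u <= / (1 + u)).
  { apply (Rmult_le_reg_r (1 + u)); [lra |]. rewrite Rinv_l by lra. nra. }
  apply Rle_trans with (1 := H). apply Rinv_le_contravar.
  - unfold halfin_whitt. nra.
  - assert (Hmg := mills_le b' g ltac:(lra)).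
    assert (c * mills b' <= g * mills g) by (apply Rmult_le_compat; lra).
    unfold halfin_whitt. lra.
Qed.

(** * The critical value of the safety factor *)

Lemma halfin_whitt_ge_1 (b : R) : 0 <= b -> 1 <= halfin_whitt b.
Proof. intros Hb. unfold halfin_whitt. assert (H := mills_pos b). nra. Qed.

Lemma halfin_whitt_threshold (P : R) :
  1 < P -> exists bstar, 0 < bstar /\
    (forall b, 0 <= b < bstar -> halfin_whitt b < P) /\
    (forall b, bstar < b -> P < halfin_whitt b).
Proof.
  intros HP. set (E := fun b => 0 <= b /\ halfin_whitt b <= P).
  assert (H0 : E 0) by (split; [| unfold halfin_whitt]; lra).
  assert (Hbound : forall b, E b -> b <= P / mills 0).
  { intros b [Hb Hb']. apply (Rle_div_r b); [apply mills_pos |].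
    unfold halfin_whitt in Hb'. assert (Hm := mills_le 0 b Hb). nra. }
  destruct (completeness E) as [s [Hub Hleast]]; [exists (P / mills 0); exact Hbound | eauto |].
  exists s. split; [| split].
  (* A positive member of [E]: [mills b1 <= mills 1] gives
     [halfin_whitt b1 <= 1 + b1 * mills 1 <= P]. *)
  - set (b1 := Rmin 1 ((P - 1) / mills 1)). assert (Hm := mills_pos 1).
    assert (Hb1 : 0 < b1) by (apply Rmin_glb_lt; [lra | apply Rdiv_lt_0_compat; lra]).
    apply Rlt_le_trans with b1; auto. apply Hub. split; [lra |]. unfold halfin_whitt.
    assert (b1 <= 1) by apply Rmin_l.
    assert (Hb1' : b1 <= (P - 1) / mills 1) by apply Rmin_r.
    apply Rle_div_r in Hb1'; auto.
    assert (H' := mills_le b1 1 ltac:(lra)). nra.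
  - intros b Hb. apply Rnot_le_lt. intros Hge.
    enough (s <= b) by lra. apply Hleast. intros x [Hx Hx']. apply Rnot_lt_le. intros Hlt.
    assert (Hlt' := halfin_whitt_lt b x). lra.
  - intros b Hb. apply Rnot_le_lt. intros Hle.
    enough (b <= s) by lra. apply Hub. split; auto. assert (0 <= s) by (apply Hub; auto). lra.
Qed.

(** * The staffing problem *)

Lemma sum_from_app (f : nat -> R) (a n n' : nat) :
  sum_from f a (n + n') = sum_from f a n + sum_from f (a + n) n'.
Proof.
  revert a. induction n as [| n IH]; intros a; simpl.
  - rewrite Nat.add_0_r. ring.
  - rewrite IH. replace (S a + n)%nat with (a + S n)%nat by lia. ring.
Qed.

Lemma sum_range_split (f : nat -> R) (a i b : nat) :
  (a <= i < b)%nat -> sum_range f a b = sum_range f a i + f i + sum_range f (S i) b.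
Proof.
  intros H. unfold sum_range. replace (b - a)%nat with ((i - a) + S (b - S i))%nat by lia.
  rewrite sum_from_app. replace (a + (i - a))%nat with i by lia. simpl. ring.
Qed.

Lemma sum_range_le (f g : nat -> R) (a b : nat) :
  (forall k, (a <= k < b)%nat -> f k <= g k) -> sum_range f a b <= sum_range g a b.
Proof.
  unfold sum_range. intros H.
  assert (H' : forall k, (a <= k < a + (b - a))%nat -> f k <= g k) by (intros; apply H; lia).
  clear H. revert H'. generalize (b - a)%nat as n. intros n. revert a.
  induction n as [| n IH]; intros a H; simpl; [lra |].
  apply Rplus_le_compat; [apply H; lia | apply IH; intros; apply H; lia].
Qed.

Lemma sum_range_lin (f g : nat -> R) (c : R) (a b : nat) :
  sum_range (fun k => f k + c * g k) a b = sum_range f a b + c * sum_range g a b.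
Proof.
  unfold sum_range. generalize (b - a)%nat as n. intros n. revert a.
  induction n as [| n IH]; intros a; simpl; [| rewrite IH]; ring.
Qed.

Lemma sum_range_0 (a b : nat) : sum_range (fun _ => 0) a b = 0.
Proof.
  unfold sum_range. generalize (b - a)%nat as n. intros n. revert a.
  induction n as [| n IH]; intros a; simpl; [| rewrite IH]; ring.
Qed.

Lemma sum_range_nonneg (f : nat -> R) (a b : nat) :
  (forall k, (a <= k < b)%nat -> 0 <= f k) -> 0 <= sum_range f a b.
Proof. intros H. rewrite <- (sum_range_0 a b). apply sum_range_le; auto. Qed.

Lemma eventually_forall_lt (n : nat) (P : nat -> nat -> Prop) :
  (forall k, (k < n)%nat -> eventually (P k)) ->
  eventually (fun m => forall k, (k < n)%nat -> P k m).
Proof.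
  induction n as [| n IH]; intros H.
  - exists 0%nat. intros; lia.
  - destruct IH as [N HN]; [intros; apply H; lia |].
    destruct (H n) as [N' HN']; [lia |].
    exists (max N N'). intros m Hm k Hk.
    destruct (Nat.eq_dec k n) as [-> | Hkn]; [apply HN' | apply HN]; lia.
Qed.

Lemma eventually_sqrt_ge (L x : R) :
  0 < L -> eventually (fun m => x <= sqrt (INR m * L)).
Proof.
  intros HL. destruct (INR_unbounded (x ^ 2 / L)) as [N HN].
  exists N. intros m Hm. apply le_INR in Hm.
  apply Rle_trans with (Rabs x); [apply Rle_abs |].
  rewrite <- sqrt_Rsqr_abs. apply sqrt_le_1_alt. rewrite Rsqr_pow2.
  apply Rle_div_l; lra.
Qed.

(** * Total delay as a function of the staffing level *)

Definition expected_delay (K : nat) (p Lam0 : nat -> R) (m : nat) (n : R) : R :=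
  sum_range (fun k => p k * alpha_bar n (Lam Lam0 m k)) 0 K.

Definition staffing_level (Lam0 : nat -> R) (m : nat) (b : R) (key : nat) : R :=
  Lam Lam0 m key + b * sqrt (Lam Lam0 m key).

Section Scenarios.

Variables (K : nat) (p Lam0 : nat -> R).
Hypothesis HLam0_pos : 0 < Lam0 0%nat.
Hypothesis HLam0_incr : forall k k', (k < k')%nat -> (k' < K)%nat -> Lam0 k < Lam0 k'.

Local Notation waiting := (expected_delay K p Lam0).
Local Notation staffing := (staffing_level Lam0).

Lemma Lam0_pos (k : nat) : (k < K)%nat -> 0 < Lam0 k.
Proof.
  intros Hk. destruct k as [| k]; auto.
  apply Rlt_trans with (1 := HLam0_pos). apply HLam0_incr; lia.
Qed.

Lemma Lam_pos (m k : nat) : (1 <= m)%nat -> (k < K)%nat -> 0 < Lam Lam0 m k.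
Proof.
  intros Hm Hk. apply Rmult_lt_0_compat; [apply lt_0_INR; lia | apply Lam0_pos; auto].
Qed.

Lemma staffing_pos (m key : nat) (b : R) :
  (1 <= m)%nat -> (key < K)%nat -> 0 <= b -> 0 < staffing m b key.
Proof.
  intros Hm Hk Hb. unfold staffing_level. assert (H := Lam_pos m key Hm Hk).
  assert (0 <= b * sqrt (Lam Lam0 m key)) by (apply Rmult_le_pos; [auto | apply sqrt_pos]). lra.
Qed.

Lemma staffing_sqrt (m key : nat) (b : R) :
  (1 <= m)%nat -> (key < K)%nat ->
  let mu := sqrt (Lam Lam0 m key) in
  0 < mu /\ Lam Lam0 m key = mu ^ 2 /\ staffing m b key = mu ^ 2 + b * mu.
Proof.
  intros Hm Hk mu. assert (H := Lam_pos m key Hm Hk).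
  assert (E : Lam Lam0 m key = mu ^ 2) by (unfold mu; rewrite pow2_sqrt; lra).
  split; [apply sqrt_lt_R0; auto | split; auto]. unfold staffing_level. fold mu. rewrite <- E. auto.
Qed.

Hypothesis Hp_pos : forall k, (k < K)%nat -> 0 < p k.

Lemma expected_delay_decr (m : nat) (n n' : R) :
  (1 <= m)%nat -> 0 < n <= n' -> waiting m n' <= waiting m n.
Proof.
  intros Hm Hn. apply sum_range_le. intros k Hk.
  apply Rmult_le_compat_l; [left; apply Hp_pos; lia |].
  apply alpha_bar_decr; [auto | apply Lam_pos; [auto | lia]].
Qed.

Lemma expected_delay_right_lipschitz (m : nat) (n : R) :
  (1 <= m)%nat -> 0 < n ->
  exists C, 0 <= C /\ forall th, 0 <= th <= 1 -> waiting m n <= waiting m (n + th) + th * C.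
Proof.
  intros Hm Hn.
  (* The condition [k < K] sits inside the existential so that constants can be chosen for all [k]
     at once; 0 is a dummy value beyond the range. *)
  assert (Hk : forall k, exists C, (k < K)%nat -> 0 <= C /\ forall th, 0 <= th <= 1 ->
    alpha_bar n (Lam Lam0 m k) <= alpha_bar (n + th) (Lam Lam0 m k) + th * C).
  { intros k. destruct (Nat.lt_ge_cases k K) as [Hk | Hk].
    - destruct (alpha_bar_right_lipschitz n (Lam Lam0 m k) Hn) as [C HC]; [apply Lam_pos; auto |].
      exists C. auto.
    - exists 0. lia. }
  set (C := fun k => proj1_sig (constructive_indefinite_description _ (Hk k))).
  assert (HC : forall k, (k < K)%nat -> 0 <= C k /\ forall th, 0 <= th <= 1 ->
    alpha_bar n (Lam Lam0 m k) <= alpha_bar (n + th) (Lam Lam0 m k) + th * C k).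
  { intros k. unfold C. apply proj2_sig. }
  exists (sum_range (fun k => p k * C k) 0 K). split.
  - apply sum_range_nonneg. intros k Hk'. apply Rmult_le_pos; [left; apply Hp_pos | apply HC]; lia.
  - intros th Hth. unfold expected_delay. rewrite <- sum_range_lin. apply sum_range_le. intros k Hk'.
    destruct (HC k) as [_ H]; [lia |]. specialize (H th Hth).
    assert (0 < p k) by (apply Hp_pos; lia). nra.
Qed.

Variables (eps : R) (i : nat).
Hypothesis Hi : (i < K)%nat.

Local Notation tail := (sum_range p (S i) K).

(** The gap between the loads of [i] and [k] is of order [m], so it eventually exceeds [B] times the
    square root of the load of [k], for any fixed [B]. The limiting delay [/ halfin_whitt B] is
    small for large [B]. *)
Lemma alpha_bar_low_scenario (k : nat) (eta : R) :
  (k < i)%nat -> 0 < eta ->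
  eventually (fun m => forall n, Lam Lam0 m i <= n -> alpha_bar n (Lam Lam0 m k) <= eta).
Proof.
  (* Chosen so that [B * mills 0 = / eta], hence [halfin_whitt B > / eta]. *)
  intros Hk Heta. set (B := / (eta * mills 0)). assert (Hm0 := mills_pos 0).
  assert (HB : 0 < B) by (apply Rinv_0_lt_compat, Rmult_lt_0_compat; auto).
  assert (HLk : 0 < Lam0 k) by (apply Lam0_pos; lia).
  assert (HLki : Lam0 k < Lam0 i) by (apply HLam0_incr; auto).
  destruct (erlang_inv_qed_ge B (/ eta)) as [mu0 [Hmu0 H]]; [lra | |].
  { unfold halfin_whitt. assert (Hm := mills_le 0 B ltac:(lra)).
    assert (E : B * mills 0 = / eta) by (unfold B; field; lra). nra. }
  destruct (eventually_sqrt_ge (Lam0 k) mu0 HLk) as [N1 HN1].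
  destruct (eventually_sqrt_ge (Lam0 k) (B * Lam0 k / (Lam0 i - Lam0 k)) HLk) as [N2 HN2].
  exists (max 1 (max N1 N2)). intros m Hm n Hn.
  specialize (HN1 m ltac:(lia)). specialize (HN2 m ltac:(lia)).
  destruct (staffing_sqrt m k B) as [Hmu [EL Est]]; [lia | lia |].
  assert (HL : 0 < Lam Lam0 m k) by (apply Lam_pos; lia).
  unfold Lam in Hmu, EL, Est, HL, Hn |- *. set (mu := sqrt (INR m * Lam0 k)) in *.
  specialize (H mu HN1).
  assert (Hle : mu ^ 2 + B * mu <= n).
  { apply Rle_trans with (2 := Hn).
    replace (INR m * Lam0 i) with (mu ^ 2 * (Lam0 i / Lam0 k)) by (rewrite <- EL; field; lra).
    apply Rle_div_l in HN2; [| lra].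
    enough (B * mu * Lam0 k <= mu ^ 2 * (Lam0 i - Lam0 k)).
    { apply (Rmult_le_reg_r (Lam0 k)); auto.
      replace (mu ^ 2 * (Lam0 i / Lam0 k) * Lam0 k) with (mu ^ 2 * Lam0 i) by (field; lra). lra. }
    nra. }
  assert (Hpos : 0 < mu ^ 2 + B * mu) by nra.
  rewrite EL. apply Rle_trans with (alpha_bar (mu ^ 2 + B * mu) (mu ^ 2)).
  - apply alpha_bar_decr; nra.
  - rewrite alpha_bar_erlang_inv. apply Rle_trans with (1 := Rmin_r _ _).
    rewrite <- (Rinv_inv eta). apply Rinv_le_contravar; auto. apply Rinv_0_lt_compat; auto.
Qed.

Lemma expected_delay_le_eventually (b : R) :
  sum_range p 0 i <= 1 -> tail < eps -> 0 <= b -> p i / (eps - tail) < halfin_whitt b ->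
  eventually (fun m => waiting m (staffing m b i) <= eps).
Proof.
  intros Hsum Htail Hb HP. set (D := halfin_whitt b) in *.
  assert (Hpi := Hp_pos i Hi).
  assert (HP0 : 0 < p i / (eps - tail)) by (apply Rdiv_lt_0_compat; lra).
  set (M := (p i / (eps - tail) + D) / 2).
  assert (HM : p i / (eps - tail) < M < D) by (unfold M; lra).
  assert (HpM : p i / M < eps - tail).
  { apply (Rlt_div_l (p i)); [lra |]. rewrite Rmult_comm.
    apply (Rlt_div_l (p i)); lra. }
  (* The room left for the scenarios below [i]; as their total weight is at most 1, a delay of [eta]
     in each is affordable. *)
  set (eta := eps - tail - p i / M). assert (Heta : 0 < eta) by (unfold eta; lra).
  destruct (eventually_forall_lt i (fun k m => forall n, Lam Lam0 m i <= n ->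
    alpha_bar n (Lam Lam0 m k) <= eta)) as [N1 HN1].
  { intros k Hk. apply alpha_bar_low_scenario; auto. }
  destruct (erlang_inv_qed_ge b M) as [mu0 [Hmu0 H]]; [auto | fold D; lra |].
  destruct (eventually_sqrt_ge (Lam0 i) mu0) as [N2 HN2]; [apply Lam0_pos; auto |].
  exists (max 1 (max N1 N2)). intros m Hm.
  specialize (HN1 m ltac:(lia)). specialize (HN2 m ltac:(lia)).
  destruct (staffing_sqrt m i b) as [Hmu [EL Est]]; [lia | auto |].
  set (n := staffing m b i) in *.
  assert (Hn : Lam Lam0 m i <= n).
  { unfold n, staffing_level.
    assert (0 <= b * sqrt (Lam Lam0 m i)) by (apply Rmult_le_pos; [auto | apply sqrt_pos]). lra. }
  unfold expected_delay. rewrite (sum_range_split _ 0 i K) by lia.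
  assert (S1 : sum_range (fun k => p k * alpha_bar n (Lam Lam0 m k)) 0 i <= eta).
  { apply Rle_trans with (sum_range (fun k => 0 + eta * p k) 0 i).
    - apply sum_range_le. intros k Hk. assert (0 < p k) by (apply Hp_pos; lia).
      specialize (HN1 k ltac:(lia) n Hn). nra.
    - rewrite sum_range_lin, sum_range_0. nra. }
  assert (S2 : p i * alpha_bar n (Lam Lam0 m i) <= p i / M).
  { apply Rmult_le_compat_l; [lra |]. rewrite alpha_bar_erlang_inv.
    apply Rle_trans with (1 := Rmin_r _ _). apply Rinv_le_contravar; [lra |].
    specialize (H _ HN2). fold (Lam Lam0 m i) in H. rewrite <- Est, <- EL in H. exact H. }
  assert (S3 : sum_range (fun k => p k * alpha_bar n (Lam Lam0 m k)) (S i) K <= tail).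
  { apply sum_range_le. intros k Hk. assert (0 < p k) by (apply Hp_pos; lia).
    assert (Ha := alpha_bar_le_1 n (Lam Lam0 m k)). nra. }
  unfold eta in S1. lra.
Qed.

(** Scenarios above [i] have loads larger by an order of [m], against a hedge of order [sqrt m], so
    they are understaffed and have delay exactly 1. Those below [i] are merely bounded by 0. *)
Lemma expected_delay_gt_eventually (b : R) :
  tail < eps -> 0 <= b -> halfin_whitt b < p i / (eps - tail) ->
  eventually (fun m => forall n, 0 < n <= staffing m b i -> eps < waiting m n).
Proof.
  intros Htail Hb HP. set (D := halfin_whitt b) in *.
  (* Makes [/ M <= 1], so the cap in [alpha_bar] respects the lower bound. *)
  assert (HD : 1 <= D) by (apply halfin_whitt_ge_1; auto).
  assert (Hpi := Hp_pos i Hi).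
  set (M := (p i / (eps - tail) + D) / 2).
  assert (HM : D < M < p i / (eps - tail)) by (unfold M; lra).
  assert (HpM : eps - tail < p i / M).
  { apply (Rlt_div_r (eps - tail)); [lra |]. rewrite Rmult_comm.
    apply (Rlt_div_r M); lra. }
  destruct (erlang_inv_qed_le b M) as [mu0 [Hmu0 H]]; [auto | fold D; lra |].
  destruct (eventually_sqrt_ge (Lam0 i) mu0) as [N1 HN1]; [apply Lam0_pos; auto |].
  destruct (eventually_forall_lt K (fun k m => (i < k)%nat -> (1 <= m)%nat ->
    staffing m b i <= Lam Lam0 m k))
    as [N2 HN2].
  { intros k Hk. destruct (Nat.lt_ge_cases i k) as [Hik | Hik]; [| exists 0%nat; lia].
    assert (HLi := Lam0_pos i Hi). assert (HLik := HLam0_incr i k Hik Hk).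
    destruct (eventually_sqrt_ge (Lam0 i) (b * Lam0 i / (Lam0 k - Lam0 i)) HLi) as [N HN].
    exists N. intros m Hm _ Hm1. specialize (HN m Hm).
    destruct (staffing_sqrt m i b) as [Hmu [EL ->]]; auto.
    unfold Lam in Hmu, EL |- *. set (mu := sqrt (INR m * Lam0 i)) in *.
    replace (INR m * Lam0 k) with (mu ^ 2 * (Lam0 k / Lam0 i)) by (rewrite <- EL; field; lra).
    apply Rle_div_l in HN; [| lra].
    apply (Rmult_le_reg_r (Lam0 i)); auto.
    replace (mu ^ 2 * (Lam0 k / Lam0 i) * Lam0 i) with (mu ^ 2 * Lam0 k) by (field; lra). nra. }
  exists (max 1 (max N1 N2)). intros m Hm n [Hn0 Hn].
  specialize (HN1 m ltac:(lia)). specialize (HN2 m ltac:(lia)).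
  destruct (staffing_sqrt m i b) as [Hmu [EL Est]]; [lia | auto |].
  unfold expected_delay. rewrite (sum_range_split _ 0 i K) by lia.
  assert (S1 : 0 <= sum_range (fun k => p k * alpha_bar n (Lam Lam0 m k)) 0 i).
  { apply sum_range_nonneg. intros k Hk. apply Rmult_le_pos; [left; apply Hp_pos; lia |].
    left. apply alpha_bar_pos; [auto | apply Lam_pos; lia]. }
  assert (S2 : p i / M <= p i * alpha_bar n (Lam Lam0 m i)).
  { apply Rmult_le_compat_l; [lra |].
    apply Rle_trans with (alpha_bar (staffing m b i) (Lam Lam0 m i)).
    - rewrite alpha_bar_erlang_inv. apply Rmin_glb.
      + rewrite <- Rinv_1. apply Rinv_le_contravar; lra.
      + apply Rinv_le_contravar.
        * apply erlang_inv_pos; [apply staffing_pos; auto; lia | apply Lam_pos; auto; lia].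
        * specialize (H _ HN1). fold (Lam Lam0 m i) in H. rewrite <- Est, <- EL in H. exact H.
    - apply alpha_bar_decr; [auto | apply Lam_pos; auto; lia]. }
  assert (S3 : tail <= sum_range (fun k => p k * alpha_bar n (Lam Lam0 m k)) (S i) K).
  { apply sum_range_le. intros k Hk. rewrite alpha_bar_eq_1; [lra |].
    split; auto. apply Rle_trans with (1 := Hn). apply HN2; lia. }
  lra.
Qed.

(* The cost is increasing in the staffing level, so the optimum is the least feasible level,
   which exists by right-continuity of [waiting m]; it lies above [Lam m i] and can therefore be expressed with key scenario [i]. *)
Lemma F_optimal_exists (cbar : R -> R) (m : nat) (b : R) :
  strictly_incr_nonneg cbar -> (1 <= m)%nat -> 0 <= b ->
  waiting m (staffing m b i) <= eps -> eps < waiting m (staffing m 0 i) ->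
  W K p Lam0 cbar eps m i.
Proof.
  intros Hc Hm Hb Hle Hgt.
  assert (HLam := Lam_pos m i Hm Hi).
  assert (Es0 : staffing m 0 i = Lam Lam0 m i) by (unfold staffing_level; ring).
  rewrite Es0 in Hgt.
  set (U := fun x => 0 < x /\ eps < waiting m x).
  assert (Hfeas : forall n x, 0 < n -> waiting m n <= eps -> U x -> x <= n).
  { intros n x Hn Hw [Hx Hx']. apply Rnot_lt_le. intros Hlt.
    assert (H := expected_delay_decr m n x Hm ltac:(lra)). lra. }
  assert (Hsp := staffing_pos m i b Hm Hi Hb).
  destruct (completeness U) as [ns [Hub Hleast]].
  { exists (staffing m b i). intros x Hx. apply Hfeas; auto. }
  { exists (Lam Lam0 m i). split; auto. }
  assert (Hns : Lam Lam0 m i <= ns) by (apply Hub; split; auto).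
  assert (Hw : waiting m ns <= eps).
  { destruct (expected_delay_right_lipschitz m ns Hm) as [C [HC H]]; [lra |].
    apply le_epsilon. intros e He.
    (* Levels above the supremum [ns] are feasible; stepping back from [ns + th] costs at most
       [th * C <= e]. *)
    set (th := Rmin 1 (e / (C + 1))).
    assert (Hth : 0 < th) by (apply Rmin_glb_lt; [lra | apply Rdiv_lt_0_compat; lra]).
    assert (Hth1 : th <= 1) by apply Rmin_l.
    assert (Hth2 : th <= e / (C + 1)) by apply Rmin_r.
    apply Rle_div_r in Hth2; [| lra].
    assert (waiting m (ns + th) <= eps).
    { apply Rnot_lt_le. intros Hlt. enough (ns + th <= ns) by lra.
      apply Hub. split; [lra | auto]. }
    specialize (H th ltac:(lra)). nra. }
  set (mu := sqrt (Lam Lam0 m i)). assert (Hmu : 0 < mu) by (apply sqrt_lt_R0; auto).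
  assert (Ens : staffing m ((ns - Lam Lam0 m i) / mu) i = ns)
    by (unfold staffing_level; fold mu; field; lra).
  exists ((ns - Lam Lam0 m i) / mu). split.
  - split; [apply Rle_mult_inv_pos; lra | split; auto].
    change (waiting m (staffing m ((ns - Lam Lam0 m i) / mu) i) <= eps). rewrite Ens. auto.
  - intros b' key [Hb' [Hkey Hw']].
    change (waiting m (staffing m b' key) <= eps) in Hw'.
    change (cbar (staffing m ((ns - Lam Lam0 m i) / mu) i) <= cbar (staffing m b' key)).
    rewrite Ens.
    assert (Hs' := staffing_pos m key b' Hm Hkey Hb').
    assert (Hle' : ns <= staffing m b' key) by (apply Hleast; intros x Hx; apply Hfeas; auto).
    destruct Hle' as [Hlt | ->]; [left; apply Hc; lra | lra].
Qed.

(** With the key scenario fixed at [i], any feasible [b'] thus bounds the optimal [b] from above, in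
    [F_m] and in [G_m] alike. *)
Lemma beta_le_of_cost_le (cbar : R -> R) (m : nat) (b b' : R) :
  strictly_incr_nonneg cbar -> (1 <= m)%nat -> 0 <= b' ->
  cost cbar Lam0 m b i <= cost cbar Lam0 m b' i -> b <= b'.
Proof.
  intros Hc Hm Hb' Hle. apply Rnot_lt_le. intros Hlt.
  enough (cost cbar Lam0 m b' i < cost cbar Lam0 m b i) by lra.
  apply Hc; [left; apply (staffing_pos m i b'); auto |].
  apply Rplus_lt_compat_l, Rmult_lt_compat_r; auto. apply sqrt_lt_R0, Lam_pos; auto.
Qed.

Lemma UB_le_inv_eventually (b P : R) :
  1 < P -> (exists b', 0 <= b' < b /\ P <= halfin_whitt b') ->
  eventually (fun m => UB b (Lam Lam0 m i) <= / P).
Proof.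
  intros HP [b' [Hb' HPb]].
  destruct (UB_le_eventually b b' Hb') as [mu0 [Hmu0 H]].
  destruct (eventually_sqrt_ge (Lam0 i) mu0) as [N HN]; [apply Lam0_pos; auto |].
  exists (max 1 N). intros m Hm. specialize (HN m ltac:(lia)).
  destruct (staffing_sqrt m i b) as [_ [EL _]]; [lia | auto |]. rewrite EL.
  apply Rle_trans with (1 := H _ HN). apply Rinv_le_contravar; lra.
Qed.

Lemma UB_ge (b : R) (m : nat) :
  (1 <= m)%nat -> 0 <= b -> / halfin_whitt b <= UB b (Lam Lam0 m i).
Proof.
  intros Hm Hb. destruct (staffing_sqrt m i b) as [Hmu [EL _]]; auto. rewrite EL.
  apply UB_bounds; auto.
Qed.

End Scenarios.

Theorem theorem7 (K : nat) (p Lam0 : nat -> R) (cbar : R -> R) (eps : R) (i : nat)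
  (Hp_pos : forall k, (k < K)%nat -> 0 < p k)
  (Hp_sum : sum_range p 0 K = 1)
  (HLam0_pos : 0 < Lam0 0%nat)
  (HLam0_incr : forall k k', (k < k')%nat -> (k' < K)%nat -> Lam0 k < Lam0 k')
  (Hc_cont : continuous_nonneg cbar)
  (Hc_incr : strictly_incr_nonneg cbar)
  (Heps : 0 < eps < 1)
  (Hi : (i < K)%nat)
  (Hi1 : sum_range p i K > eps)
  (Hi2 : sum_range p (S i) K < eps) :
  exists mbar : nat,
    (forall m, (mbar <= m)%nat -> W K p Lam0 cbar eps m i) /\
    exists bstar, 0 < bstar /\
      forall betaF betaG : nat -> R,
        (forall m, (mbar <= m)%nat -> F_optimal K p Lam0 cbar eps m (betaF m) i) ->
        (forall m, (mbar <= m)%nat -> G_optimal K p Lam0 cbar eps i m (betaG m)) ->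
        Un_cv betaG bstar /\ Un_cv betaF bstar.
Proof.
  assert (Hpi := Hp_pos i Hi).
  assert (Hsum : sum_range p 0 i <= 1).
  { rewrite <- Hp_sum, (sum_range_split p 0 i K) by lia.
    assert (0 <= sum_range p (S i) K)
      by (apply sum_range_nonneg; intros; left; apply Hp_pos; lia). lra. }
  rewrite (sum_range_split p i i K) in Hi1 by lia.
  unfold sum_range at 1 in Hi1. rewrite Nat.sub_diag in Hi1. simpl in Hi1.
  set (tail := sum_range p (S i) K) in *.
  set (P := p i / (eps - tail)).
  assert (HP : 1 < P) by (apply (Rlt_div_r 1); lra).
  assert (EP : p i * / P = eps - tail) by (unfold P; field; lra).
  destruct (halfin_whitt_threshold P HP) as [bs [Hbs [Hlow Hhigh]]].
  assert (Hle : forall b, bs < b -> eventually (fun m => F_feasible K p Lam0 eps m b i)).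
  { intros b Hb.
    destruct (expected_delay_le_eventually K p Lam0 HLam0_pos HLam0_incr Hp_pos eps i Hi b)
      as [N HN]; auto; [lra |].
    exists N. intros m Hm. split; [lra | split; auto]. apply HN; auto. }
  assert (Hgt : forall b, 0 <= b < bs -> eventually (fun m => forall b',
      0 <= b' -> F_feasible K p Lam0 eps m b' i -> b < b')).
  { intros b Hb.
    destruct (expected_delay_gt_eventually K p Lam0 HLam0_pos HLam0_incr Hp_pos eps i Hi b)
      as [N HN]; auto; [lra |].
    exists (max 1 N). intros m Hm b' Hb' [_ [_ Hw]]. apply Rnot_le_lt. intros Hbb.
    enough (eps < sum_range (fun k => p k * alpha_bar (Lam Lam0 m i + b' * sqrt (Lam Lam0 m i))
      (Lam Lam0 m k)) 0 K) by lra.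
    apply HN; [lia |]. split.
    - apply (staffing_pos K Lam0 HLam0_pos HLam0_incr m i b'); auto; lia.
    - apply Rplus_le_compat_l, Rmult_le_compat_r; [apply sqrt_pos | auto]. }
  (* [F_optimal_exists] needs one feasible hedge, for which any point above [bs] would do, and
     infeasibility of the hedge 0. *)
  destruct (Hle (bs + 1)) as [N1 HN1]; [lra |].
  destruct (expected_delay_gt_eventually K p Lam0 HLam0_pos HLam0_incr Hp_pos eps i Hi 0)
    as [N2 HN2]; auto; [lra | apply Hlow; lra |].
  exists (max 1 (max N1 N2)). split.
  { intros m Hm.
    apply (F_optimal_exists K p Lam0 HLam0_pos HLam0_incr Hp_pos eps i Hi cbar m (bs + 1));
      auto; [lia | lra | apply HN1; lia |].
    apply HN2; [lia |]. split; [| lra].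
    apply (staffing_pos K Lam0 HLam0_pos HLam0_incr m i 0); auto; [lia | lra]. }
  exists bs. split; auto. intros betaF betaG HF HG. split.
  - intros e He.
    destruct (UB_le_inv_eventually K Lam0 HLam0_pos HLam0_incr i Hi (bs + e / 2) P HP)
      as [N HN].
    (* Any point strictly between [bs] and [bs + e / 2] works. *)
    { exists (bs + e / 4). split; [lra |]. left. apply Hhigh. lra. }
    exists (max N (max 1 (max N1 N2))). intros m Hm.
    destruct (HG m) as [[Hb HUB] Hopt]; [lia |].
    assert (Hup : betaG m <= bs + e / 2).
    { apply (beta_le_of_cost_le K Lam0 HLam0_pos HLam0_incr i Hi cbar m); auto; [lia | lra |].
      apply Hopt. split; [lra |]. fold tail. rewrite <- EP.
      apply Rmult_le_compat_l; [lra | apply HN; lia]. }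
    (* Because [/ halfin_whitt b <= UB b lam] holds for every load, [betaG] approaches [bs] from
       above. *)
    assert (Hlo : bs <= betaG m).
    { apply Rnot_lt_le. intros Hlt. assert (HD := Hlow (betaG m) (conj Hb Hlt)).
      assert (HU := UB_ge K Lam0 HLam0_pos HLam0_incr i Hi (betaG m) m ltac:(lia) Hb).
      assert (H1 := halfin_whitt_ge_1 (betaG m) Hb).
      assert (/ P < / halfin_whitt (betaG m)) by (apply Rinv_lt_contravar; [nra | auto]).
      fold tail in HUB. nra. }
    apply Rabs_def1; lra.
  - intros e He.
    destruct (Hle (bs + e / 2)) as [N HN]; [lra |].
    (* [Hgt] requires a nonnegative point below [bs], and [bs - e / 2] may be negative. *)
    destruct (Hgt (Rmax 0 (bs - e / 2))) as [N' HN'].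
    { split; [apply Rmax_l | apply Rmax_lub_lt; lra]. }
    exists (max (max N N') (max 1 (max N1 N2))). intros m Hm.
    destruct (HF m) as [Hfeas Hopt]; [lia |].
    assert (Hup : betaF m <= bs + e / 2).
    { apply (beta_le_of_cost_le K Lam0 HLam0_pos HLam0_incr i Hi cbar m); auto; [lia | lra |].
      apply Hopt. apply HN; lia. }
    assert (Hlo := HN' m ltac:(lia) (betaF m) (proj1 Hfeas) Hfeas).
    assert (Hmax := Rmax_r 0 (bs - e / 2)).
    apply Rabs_def1; lra.
Qed.
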